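(* For every $n\in\mathbb N$, every origin-symmetric convex sets $K,L\subseteq\mathbb R^n$ and every $\lambda\in(0,1)$, $$\gamma_n\big(\lambda K+(1-\lambda)L\big)^{\frac{1}{n}} \geq \lambda\, \gamma_n(K)^{\frac{1}{n}}+(1-\lambda)\,\gamma_n(L)^{\frac{1}{n}}.$$
   Context: $\gamma_n$ denotes the standard Gaussian measure on $\mathbb R^n$, $\mathrm{d}\gamma_n(x)=(2\pi)^{-n/2}e^{-|x|^2/2}\,\mathrm{d}x$, where $|x|$ is the Euclidean norm. A set $K$ is (origin-)symmetric if $K=-K$. The Minkowski combination is $\lambda K+(1-\lambda)L=\{\lambda a+(1-\lambda)b:\ a\in K,\ b\in L\}$. *)

(* Defs.v *)
From HB Require Import structures.
From mathcomp Require Import all_boot all_order all_algebra.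
From mathcomp Require Import all_classical all_reals all_analysis.
Set Implicit Arguments. Unset Strict Implicit. Unset Printing Implicit Defensive.
Import Order.TTheory GRing.Theory Num.Theory.
Local Open Scope classical_set_scope.
Local Open Scope ring_scope.

Definition box (R : realType) (n : nat) (a b : 'rV[R]_n) : set 'rV[R]_n :=
  [set x | forall i : 'I_n, a ord0 i < x ord0 i <= b ord0 i].

Definition box_gauss (R : realType) (n : nat) (a b : 'rV[R]_n) : R :=
  \prod_(i < n) fine (normal_prob 0 1 `]a ord0 i, b ord0 i]).

(* The standard Gaussian measure gamma_n on R^n, given on an arbitrary
   subset A by the Caratheodory (outer-measure) extension from boxes:
   the infimum of sum_k gamma_n(B_k) over countable box covers of A.
   On Lebesgue-measurable sets (in particular convex sets) this is the
   (completed) product measure gamma_n. *)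
Definition gauss_measure (R : realType) (n : nat) (A : set 'rV[R]_n) : \bar R :=
  ereal_inf [set (\sum_(0 <= k <oo) (box_gauss (ab.1 k) (ab.2 k))%:E)%E
            | ab in [set ab : (nat -> 'rV[R]_n) * (nat -> 'rV[R]_n)
                     | A `<=` \bigcup_k box (ab.1 k) (ab.2 k)]].

Definition origin_symmetric (R : realType) (n : nat) (K : set 'rV[R]_n) :=
  K = [set - x | x in K].

Definition minkowski_comb (R : realType) (n : nat) (lambda : R)
    (K L : set 'rV[R]_n) : set 'rV[R]_n :=
  [set lambda *: a + (1 - lambda) *: b | a in K & b in L].

Definition convex (R : realType) (n : nat) (K : set 'rV[R]_n) :=
  @convex_set R 'rV[R]_n K.

(* Main.v *)
(** Fix positive reals [a], [b] with [a ^ n <= gamma (K)] and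
    [b ^ n <= gamma (L)].  Replacing [K] and [L] by [K / a] and [L / b], the
    inequality becomes log-concavity in [s] of
      [F s = \int_(K_s) exp (- |x|^2 / (2 * p(s)^2)) dx],
    where [K_s = (1 - s) * K + s * L] and [p] is affine and positive.

    To compare [F (s + t) * F (s - t)] with [F (s) ^ 2], write the product as a
    double integral in [x = m + d/2], [y = m - d/2].  For fixed [m], exchanging
    [t] and [- t] amounts to reflecting [d], so the midpoint Prekopa-Leindler
    inequality in [d] gives
      [F (s + t) F (s - t) <= \int\int_(K_s * K_s)
         exp (- (|x|^2 + |y|^2) / (2 p(s)^2) + c <x, y>) dx dy]
    with [c = O(t^2)].  By symmetry of [K_s] the exponential of [c <x, y>] can be
    replaced by its hyperbolic cosine, whence
      [F (s + t) F (s - t) <= (1 + O(t^4)) F(s)^2].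
    The error is [o(t^2)], so a discrete minimum principle on the grid [k / N]
    gives log-concavity of [F] between the end points when [N] goes to infinity.

    Symmetry thus only enters through the vanishing of the odd part of
    [exp (c <x, y>)]; it replaces the Poincare inequality for odd functions. *)
Require Import Defs.
From HB Require Import structures.
From mathcomp Require Import all_boot all_order all_algebra.
From mathcomp Require Import all_classical all_reals all_analysis.
From mathcomp Require Import measurable_realfun ring lra zify.
Import Order.TTheory GRing.Theory Num.Theory.
Local Open Scope classical_set_scope.
Local Open Scope ring_scope.

Set Implicit Arguments. Unset Strict Implicit. Unset Printing Implicit Defensive.

(** * Lebesgue measure on row vectors *)

Section rv_measurable.
(* The pointed structure on ['rV[R]_n] that [isMeasurable] requires is only
   inferred through the topology of [R]. *)
Import numFieldTopology.Exports.
Context {R : realType} {n : nat}.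

(** A dilation by [c] multiplies an integral of [exp (- q |x|^2 / 2)] by [c ^ n] and turns [q] into
    [q c^2]. With [p (0) = 1 / a], [p (1) = 1 / b] and [kappa] the normalising constant of the
    density, both [F (0)] and [F (1)] are therefore at least [1 / kappa]. Put [c = l a + (1 - l) b].
    At [s = (1 - l) b / c] one finds [p (s) = 1 / c] and [K_s = (l K + (1 - l) L) / c], so
    [F (s) >= 1 / kappa] is exactly the claim: only a lower bound by the end values is needed.

    A factor [1 + O(h^4)] at each node of a grid of step [h] accumulates to [1 + O(h^2)], since a
    unit second difference is inverted by a function of size [1 / h^2].

    Three obstacles shape the rest. The error constant involves a bound on [<x, y>], so sets are cut
    down to cubes. A grid reaches rational parameters only, so [a] is perturbed. The measure in the
    statement is an outer measure, so convex sets are replaced by open neighbourhoods; the cost of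
    this is controlled because a symmetric convex set either contains a cube or lies in a
    hyperplane. *)

Definition rv_coor (i : 'I_n) (x : 'rV[R]_n) : measurableTypeR R := x ord0 i.

Let rv_set0 : g_sigma_preimage rv_coor set0.
Proof. exact: sigma_algebra0. Qed.

Let rv_setC A : g_sigma_preimage rv_coor A -> g_sigma_preimage rv_coor (~` A).
Proof.
by rewrite /g_sigma_preimage => h; rewrite -setTD; exact: sigma_algebraCD.
Qed.

Let rv_bigcup (F : _^nat) : (forall i, g_sigma_preimage rv_coor (F i)) ->
  g_sigma_preimage rv_coor (\bigcup_i (F i)).
Proof. exact: sigma_algebra_bigcup. Qed.

HB.instance Definition _ := @isMeasurable.Build default_measure_display
  'rV[R]_n (g_sigma_preimage rv_coor) rv_set0 rv_setC rv_bigcup.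

Lemma measurable_rv_coor (i : 'I_n) :
  measurable_fun [set: 'rV[R]_n] (rv_coor i).
Proof.
move=> _ Y mY; rewrite setTI; apply: sub_sigma_algebra => /=.
rewrite -bigcup_seq/=; exists i => /=; first by rewrite mem_index_enum.
by exists Y => //; rewrite setTI.
Qed.

Lemma measurable_fun_rvP d (T : measurableType d) (f : T -> 'rV[R]_n) :
  (forall i, measurable_fun setT (fun t => rv_coor i (f t))) ->
  measurable_fun setT f.
Proof.
move=> mf; have H : g_sigma_preimage (fun i => rv_coor i \o f) `<=` measurable.
  apply: smallest_sub; first exact: sigma_algebra_measurable.
  rewrite -bigcup_seq; apply: bigcup_sub => i _.
  by move=> A [B mB <-]; exact: mf.
move: H; rewrite g_sigma_preimage_comp => prefS.
by move=> _ A mA; apply: prefS; exists A.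
Qed.

End rv_measurable.

Section vcons.
Context {R : realType} {n : nat}.

Definition vcons (t : R) (x : 'rV[R]_n) : 'rV[R]_n.+1 :=
  \row_i (if unlift ord0 i is Some j then x ord0 j else t).

Lemma vcons0 t x : vcons t x ord0 ord0 = t.
Proof. by rewrite mxE unlift_none. Qed.

Lemma vconsS t x j : vcons t x ord0 (lift ord0 j) = x ord0 j.
Proof. by rewrite mxE liftK. Qed.

Lemma vcons_eta (x : 'rV[R]_n.+1) :
  x = vcons (x ord0 ord0) (\row_j x ord0 (lift ord0 j)).
Proof.
apply/rowP => i; case: (unliftP ord0 i) => [j|] ->; last by rewrite vcons0.
by rewrite vconsS mxE.
Qed.

Lemma vconsD t u x y : vcons t x + vcons u y = vcons (t + u) (x + y).
Proof.
apply/rowP => i; rewrite mxE.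
by case: (unliftP ord0 i) => [j|] ->; rewrite ?vcons0 ?vconsS ?mxE.
Qed.

Lemma vconsZ c t x : c *: vcons t x = vcons (c * t) (c *: x).
Proof.
apply/rowP => i; rewrite mxE.
by case: (unliftP ord0 i) => [j|] ->; rewrite ?vcons0 ?vconsS ?mxE.
Qed.

Lemma measurable_vcons_fun d (T : measurableType d) (f : T -> measurableTypeR R) (g : T -> 'rV[R]_n) :
  measurable_fun setT f -> measurable_fun setT g ->
  measurable_fun setT (fun t => vcons (f t) (g t)).
Proof.
move=> mf mg; apply: measurable_fun_rvP => i.
case: (unliftP ord0 i) => [j|] ->.
  apply: (eq_measurable_fun (rv_coor j \o g)) => /=.
    by move=> t _; rewrite /rv_coor vconsS.
  exact: measurableT_comp (measurable_rv_coor j) mg.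
by apply: eq_measurable_fun mf => t _; rewrite /rv_coor vcons0.
Qed.

End vcons.

Section step.
Context {R : realType} {n : nat}.

Definition vconsp (p : measurableTypeR R * 'rV[R]_n) : 'rV[R]_n.+1 := vcons p.1 p.2.

Lemma measurable_vconsp : measurable_fun setT vconsp.
Proof. by apply: measurable_vcons_fun; [exact: measurable_fst|exact: measurable_snd]. Qed.

HB.instance Definition _ := isMeasurableFun.Build _ _ _ _ vconsp measurable_vconsp.

Variable m : {sigma_finite_measure set 'rV[R]_n -> \bar R}.

Definition mu_step : set 'rV[R]_n.+1 -> \bar R :=
  pushforward (@lebesgue_measure R \x m)%E vconsp.

Let mu_step_measure : {measure set 'rV[R]_n.+1 -> \bar R} :=
  measure_function_pushforward__canonical__measure_function_Measure
    (@lebesgue_measure R \x m)%E measurable_vconsp.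

HB.instance Definition _ := isMeasure.Build _ _ _ mu_step
  (measure0 mu_step_measure) (measure_ge0 mu_step_measure)
  (@measure_semi_sigma_additive _ _ _ mu_step_measure).

Lemma mu_step_sigma_finite : sigma_finite setT mu_step.
Proof.
have /sigma_finiteP[F [TF ndF Foo]] := sigma_finiteT (@lebesgue_measure R).
have /sigma_finiteP[G [TG ndG Goo]] := sigma_finiteT m.
(* [un] inverts [vconsp]; pulling products of the two exhaustions back along it gives an exhaustion
   by sets of finite measure. *)
pose un (x : 'rV[R]_n.+1) : measurableTypeR R * 'rV[R]_n :=
  (rv_coor ord0 x, \row_j x ord0 (lift ord0 j)).
have mUn : measurable_fun setT un.
  apply: measurable_fun_pair => /=; first exact: measurable_rv_coor.
  apply: measurable_fun_rvP => i.
  apply: eq_measurable_fun (measurable_rv_coor (lift ord0 i)).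
  by move=> x _; rewrite /rv_coor mxE.
have unK p : un (vconsp p) = p.
  case: p => t x; rewrite /un /vconsp /rv_coor /= vcons0; congr pair.
  by apply/rowP => j; rewrite mxE vconsS.
exists (fun k => un @^-1` (F k `*` G k)).
  rewrite predeqE => x; split=> // _.
  have [k _ Fk] : (\bigcup_k F k) (un x).1 by rewrite -TF.
  have [l _ Gl] : (\bigcup_k G k) (un x).2 by rewrite -TG.
  exists (maxn k l) => //; split.
  - by move: (un x).1 Fk; exact/subsetPset/ndF/leq_maxl.
  - by move: (un x).2 Gl; exact/subsetPset/ndG/leq_maxr.
move=> k; have [mF Fk] := Foo k; have [mG Gk] := Goo k; split.
  by rewrite -[X in measurable X]setTI; apply: mUn => //; exact: measurableX.
rewrite /mu_step /pushforward -comp_preimage.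
rewrite (_ : un \o vconsp = id); last by apply/funext => p /=.
by rewrite preimage_id product_measure1E// lte_mul_pinfty// ge0_fin_numE.
Qed.

HB.instance Definition _ := Measure_isSigmaFinite.Build _ _ _ mu_step mu_step_sigma_finite.

Definition mu_next : {sigma_finite_measure set 'rV[R]_n.+1 -> \bar R} := mu_step.

End step.

(** Peeling off one coordinate at a time makes Tonelli available in either order at each dimension.
    In dimension 0 the measure is the unit mass at the only point, so that empty products integrate
    to 1. *)
Fixpoint lebesgue_rV (R : realType) (n : nat) : {sigma_finite_measure set 'rV[R]_n -> \bar R} :=
  if n is k.+1 then mu_next (lebesgue_rV R k) else (\d_(0 : 'rV[R]_0) : {sigma_finite_measure set _ -> \bar R}).

Section rv_ops.
Context {R : realType} {n : nat} d (T : measurableType d).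
Implicit Types f g : T -> 'rV[R]_n.

Lemma measurable_rv_fun f i : measurable_fun setT f ->
  measurable_fun setT (fun t => f t ord0 i : measurableTypeR R).
Proof. by move=> mf; exact: measurableT_comp (measurable_rv_coor i) mf. Qed.

Lemma measurable_rvD f g : measurable_fun setT f -> measurable_fun setT g ->
  measurable_fun setT (fun t => f t + g t).
Proof.
move=> mf mg; apply: measurable_fun_rvP => i; rewrite /rv_coor.
under eq_fun do rewrite mxE.
by apply: measurable_funD; exact: measurable_rv_fun.
Qed.

Lemma measurable_rvZ f (c : R) : measurable_fun setT f ->
  measurable_fun setT (fun t => c *: f t).
Proof.
move=> mf; apply: measurable_fun_rvP => i; rewrite /rv_coor.
under eq_fun do rewrite mxE.
by apply: measurable_funM => //; exact: measurable_rv_fun.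
Qed.

Lemma measurable_rvB f g : measurable_fun setT f -> measurable_fun setT g ->
  measurable_fun setT (fun t => f t - g t).
Proof.
move=> mf mg; apply: measurable_rvD => //.
by under eq_fun do rewrite -scaleN1r; exact: measurable_rvZ.
Qed.

End rv_ops.

Section mun_integral.
Context {R : realType}.
Local Open Scope ereal_scope.
Local Notation leb := (@lebesgue_measure R).

Lemma integral_lebesgue_rV0 (f : 'rV[R]_0 -> \bar R) : measurable_fun setT f ->
  \int[lebesgue_rV R 0]_x f x = f 0%R.
Proof. by move=> mf; rewrite /= integral_dirac// diracE mem_set// mul1e. Qed.

Variable n : nat.
Variable f : 'rV[R]_n.+1 -> \bar R.
Hypotheses (mf : measurable_fun setT f) (f0 : forall x, 0 <= f x).

Let mfv : measurable_fun setT (f \o @vconsp R n).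
Proof. exact: measurableT_comp mf (@measurable_vconsp R n). Qed.

Let integral_prod :
  \int[lebesgue_rV R n.+1]_x f x = \int[(leb \x lebesgue_rV R n)]_p f (vconsp p).
Proof.
by rewrite /= /mu_next /mu_step ge0_integral_pushforward.
Qed.

Lemma integral_lebesgue_rVS : \int[lebesgue_rV R n.+1]_x f x =
  \int[leb]_t \int[lebesgue_rV R n]_x f (vcons t x).
Proof. by rewrite integral_prod fubini_tonelli1//; move=> p; exact: f0. Qed.

Lemma integral_lebesgue_rVS_swap : \int[lebesgue_rV R n.+1]_x f x =
  \int[lebesgue_rV R n]_x \int[leb]_t f (vcons t x).
Proof. by rewrite integral_prod fubini_tonelli2//; move=> p; exact: f0. Qed.

Lemma measurable_integral_vcons :
  measurable_fun setT (fun t : measurableTypeR R => \int[lebesgue_rV R n]_x f (vcons t x)).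
Proof. by apply: (measurable_fun_fubini_tonelli_F _ mfv) => p; exact: f0. Qed.

End mun_integral.

(** * Affine changes of variables *)

Section affine.
Context {R : realType}.
Local Open Scope ereal_scope.
Local Notation leb := (@lebesgue_measure R).

(** [c] times the pushforward of Lebesgue measure under [t -> c t + b] agrees with Lebesgue measure
    on half-open intervals, which determine it. *)
Lemma lebesgue_affine_pos (c b : R) (A : set (measurableTypeR R)) : (0 < c)%R ->
  measurable A ->
  leb ((fun t => c * t + b)%R @^-1` A) = (c^-1)%:E * leb A.
Proof.
move=> c0 mA.
pose g (t : measurableTypeR R) : measurableTypeR R := (c * t + b)%R.
have mg : measurable_fun setT g by apply: measurable_funD => //; exact: measurable_funM.
have c0' : (0 <= c)%R by exact: ltW.
pose m : {measure set _ -> \bar R} := measure_function_pushforward__canonical__measure_function_Measure leb mg.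
have := @lebesgue_measure_unique R (mscale (NngNum c0') m).
have H X : ocitv X -> leb X = mscale (NngNum c0') m X.
  move=> -[[x y] _ <-] /=; rewrite /mscale /= /pushforward.
  have -> : g @^-1` [set` `]x, y]%R] = [set` `]((x - b) / c), ((y - b) / c)]%R].
    apply/seteqP; split => t; rewrite /g /= !in_itv /=.
      by rewrite ltr_pdivrMr// ler_pdivlMr// ltrBlDr lerBrDr ![(t * c)%R]mulrC.
    by rewrite ltr_pdivrMr// ler_pdivlMr// ltrBlDr lerBrDr ![(t * c)%R]mulrC.
  rewrite !lebesgue_measure_itv/= !lte_fin ltr_pM2r ?invr_gt0// ltrD2r.
  case: ifP => _; last by rewrite mule0.
  rewrite -!EFinD -EFinM; congr EFin.
  by rewrite -mulrBl opprD addrACA subrr addr0 mulrCA divff ?mulr1// gt_eqF.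
move=> /(_ H A mA) ->; rewrite /mscale /= muleA -EFinM mulVf ?mul1e ?gt_eqF//.
Qed.

Lemma lebesgue_affine (c b : R) (A : set (measurableTypeR R)) : c != 0%R ->
  measurable A ->
  leb ((fun t => c * t + b)%R @^-1` A) = (`|c|^-1)%:E * leb A.
Proof.
move=> c0 mA; have [c_gt0|] := ltP 0%R c.
  by rewrite gtr0_norm// lebesgue_affine_pos.
rewrite le_eqVlt (negPf c0)/= => c_lt0; rewrite ltr0_norm//.
rewrite -(@lebesgue_affine_pos (- c) b)// ?oppr_gt0//.
rewrite -[RHS]lebesgue_measureN; last first.
  rewrite -[X in measurable X]setTI.
  pose g (t : measurableTypeR R) : measurableTypeR R := (- c * t + b)%R.
  have mg : measurable_fun setT g.
    by apply: measurable_funD => //; exact: measurable_funM.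
  exact: mg.
by rewrite /pushforward; congr (leb _); apply/seteqP; split => t /=;
  rewrite mulrNN.
Qed.

Lemma ge0_integral_affine1 (c b : R) (f : measurableTypeR R -> \bar R) : c != 0%R ->
  measurable_fun setT f -> (forall t, 0 <= f t) ->
  \int[leb]_t f (c * t + b)%R = (`|c|^-1)%:E * \int[leb]_t f t.
Proof.
move=> c0 mf f0.
pose g (t : measurableTypeR R) : measurableTypeR R := (c * t + b)%R.
have mg : measurable_fun setT g by apply: measurable_funD => //; exact: measurable_funM.
pose m : {measure set _ -> \bar R} := measure_function_pushforward__canonical__measure_function_Measure leb mg.
have c0' : (0 <= `|c|^-1)%R by rewrite invr_ge0.
transitivity (\int[m]_t f t).
  by rewrite ge0_integral_pushforward.
rewrite -(@ge0_integral_mscale _ _ _ leb setT measurableT (NngNum c0'))//.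
by apply: eq_measure_integral => A mA _; exact: lebesgue_affine.
Qed.

Lemma ge0_integral_affine n (c : R) (b : 'rV[R]_n) (f : 'rV[R]_n -> \bar R) :
  c != 0%R -> measurable_fun setT f -> (forall x, 0 <= f x) ->
  \int[lebesgue_rV R n]_x f (c *: x + b)%R = ((`|c|^-1) ^+ n)%:E * \int[lebesgue_rV R n]_x f x.
Proof.
move=> c0; elim: n b f => [|n IH] b f mf f0.
  rewrite !integral_lebesgue_rV0//; last first.
    apply: measurableT_comp => //; apply: measurable_rvD => //.
    exact: measurable_rvZ.
  by rewrite expr0 mul1e; congr f; apply/rowP => -[].
have mfa : measurable_fun setT (fun x : 'rV[R]_n.+1 => f (c *: x + b)%R).
  apply: measurableT_comp => //; apply: measurable_rvD => //.
  exact: measurable_rvZ.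
have mfv t : measurable_fun setT (fun x : 'rV[R]_n => f (vcons t x)).
  by apply: measurableT_comp => //; exact: measurable_vcons_fun.
rewrite !integral_lebesgue_rVS//.
rewrite (vcons_eta b); set b0 := b _ _; set b' := (\row_j _)%R.
under eq_integral do under eq_integral do rewrite vconsZ vconsD.
under eq_integral.
  move=> t _; rewrite (IH b' (fun x => f (vcons (c * t + b0)%R x)))//; over.
have mF : measurable_fun setT (fun t : measurableTypeR R => \int[lebesgue_rV R n]_x f (vcons t x)).
  exact: measurable_integral_vcons.
have F0 t : 0 <= \int[lebesgue_rV R n]_x f (vcons t x) by exact: integral_ge0.
have mg : measurable_fun setT
    (fun t : measurableTypeR R => (c * t + b0)%R : measurableTypeR R).
  by apply: measurable_funD => //; exact: measurable_funM.
have mFg : measurable_fun setT (fun t : measurableTypeR R =>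
    \int[lebesgue_rV R n]_x f (vcons (c * t + b0)%R x)).
  exact: (measurableT_comp mF mg).
have cn0 : 0 <= ((`|c|^-1) ^+ n)%:E by rewrite lee_fin exprn_ge0// invr_ge0.
rewrite (ge0_integralZl leb measurableT mFg (fun t _ => F0 (c * t + b0)%R) cn0).
rewrite (@ge0_integral_affine1 c b0 (fun t => \int[lebesgue_rV R n]_x f (vcons t x)))//.
by rewrite muleA -EFinM exprSr.
Qed.

End affine.

(** * The midpoint Prekopa-Leindler inequality *)

Section brunn_minkowski1.
Context {R : realType}.
Import numFieldNormedType.Exports.
Local Notation leb := (@lebesgue_measure R).

Let pre_affine (c b : R) (A : set (measurableTypeR R)) : measurable A ->
  measurable ((fun t : measurableTypeR R => c * t + b : measurableTypeR R) @^-1` A).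
Proof.
move=> mA; rewrite -[X in measurable X]setTI.
have mg : measurable_fun setT (fun t : measurableTypeR R => c * t + b : measurableTypeR R).
  by apply: measurable_funD => //; exact: measurable_funM.
exact: mg.
Qed.

(** [A] need not have a largest element, but its compact subsets do, and by inner regularity they
    suffice. *)
Lemma lebesgue_sup_le (A : set (measurableTypeR R)) (M : \bar R) :
  measurable A -> A !=set0 ->
  (forall a, A a -> (leb (A `&` [set` `]-oo, a]%R]) <= M)%E) -> (leb A <= M)%E.
Proof.
move=> mA [a0 Aa0] H; rewrite lebesgue_regularity_inner_sup//.
apply: ge_ereal_sup => _ [K [cK KA] <-].
have [->|/set0P K0] := eqVneq K set0.
  rewrite measure0; apply: le_trans (H a0 Aa0); exact: measure_ge0.
have [|c /set_mem Kc Kmax] := @compact_EVT_max R R id K K0 cK.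
  by apply: continuous_subspaceT => x; exact: cvg_id.
apply: le_trans (H c (KA _ Kc)); apply: le_measure; rewrite ?inE.
- exact: (closed_measurable (compact_closed (@Rhausdorff R) cK)).
- by apply: measurableI => //; exact: measurable_itv.
- move=> x Kx; split; first exact: KA.
  by rewrite /= in_itv/=; apply: Kmax; rewrite inE.
Qed.

(** The half-line is open at [a], so the least point of a compact subset is lost; it is a null
    set. *)
Lemma lebesgue_sup_le_right (A : set (measurableTypeR R)) (M : \bar R) :
  measurable A -> A !=set0 ->
  (forall a, A a -> (leb (A `&` [set` `]a, +oo[%R]) <= M)%E) -> (leb A <= M)%E.
Proof.
move=> mA [a0 Aa0] H; rewrite lebesgue_regularity_inner_sup//.
apply: ge_ereal_sup => _ [K [cK KA] <-].
have [->|/set0P K0] := eqVneq K set0.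
  rewrite measure0; apply: le_trans (H a0 Aa0); exact: measure_ge0.
have [|c /set_mem Kc Kmin] := @compact_EVT_min R R id K K0 cK.
  by apply: continuous_subspaceT => x; exact: cvg_id.
have mK : measurable (K : set (measurableTypeR R)).
  exact: (closed_measurable (compact_closed (@Rhausdorff R) cK)).
apply: le_trans (H c (KA _ Kc)).
have KE : leb K = leb (K `\` [set c]).
  rewrite (@measureDI _ _ _ leb K [set c])// (_ : K `&` [set c] = [set c]).
    by rewrite [X in (_ + X)%E](_ : _ = 0%E) ?adde0//; exact: lebesgue_measure_set1.
  by apply/seteqP; split => [x []//|x ->].
apply: (@le_trans _ _ (leb (K `\` [set c]))); first by rewrite -KE.
apply: le_measure; rewrite ?inE.
- by apply: measurableD.
- by apply: measurableI => //; exact: measurable_itv.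
- move=> x [Kx xc]; split; first exact: KA.
  rewrite /= in_itv/= andbT lt_neqAle; apply/andP; split.
    by apply/eqP => cx; apply: xc.
  by apply: Kmin; rewrite inE.
Qed.

(* Anchoring at points a of A and b of B splits C at (a + b) / 2: the left half
   contains a scaled copy of the part of A below a, the right half one of the
   part of B above b. *)
Lemma brunn_minkowski1 (A B C : set (measurableTypeR R)) :
  measurable A -> measurable B -> measurable C ->
  A !=set0 -> B !=set0 ->
  (forall a b, A a -> B b -> C ((a + b) / 2)) ->
  (leb A + leb B <= 2%:E * leb C)%E.
Proof.
move=> mA mB mC A0 B0 ABC.
have key a b : A a -> B b ->
    (leb (A `&` [set` `]-oo, a]%R]) + leb (B `&` [set` `]b, +oo[%R])
     <= 2%:E * leb C)%E.
  move=> Aa Bb.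
  pose p := (a + b) / 2.
  have mAa : measurable (A `&` [set` `]-oo, a]%R]).
    by apply: measurableI => //; exact: measurable_itv.
  have mBb : measurable (B `&` [set` `]b, +oo[%R]).
    by apply: measurableI => //; exact: measurable_itv.
  have mCl : measurable (C `&` [set` `]-oo, p]%R]).
    by apply: measurableI => //; exact: measurable_itv.
  have mCr : measurable (C `&` [set` `]p, +oo[%R]).
    by apply: measurableI => //; exact: measurable_itv.
  have CE : leb C = (leb (C `&` [set` `]-oo, p]%R]) + leb (C `&` [set` `]p, +oo[%R]))%E.
    rewrite -measureU//.
      rewrite -setIUr (_ : _ `|` _ = setT) ?setIT//.
      apply/seteqP; split => // x _ /=; rewrite !in_itv/= andbT.
      by apply/orP; case: leP.
    apply/seteqP; split => // x [[_ +] [_]] /=; rewrite !in_itv/= andbT.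
    by move=> xp px; move: (lt_le_trans px xp); rewrite ltxx.
  have half (X : set (measurableTypeR R)) c : measurable X ->
      (leb X = 2%:E * leb ((fun t => 2 * t + c)%R @^-1` X))%E.
    move=> mX; rewrite lebesgue_affine// muleA -EFinM ger0_norm//.
    by rewrite divff// mul1e.
  rewrite CE muleDr//; last by apply: ge0_adde_def; rewrite inE measure_ge0.
  rewrite (half _ (- b) mAa) (half _ (- a) mBb).
  apply: leeD; apply: lee_wpmul2l => //; apply: le_measure; rewrite ?inE//.
  - exact: pre_affine.
  - move=> t /= [At]; rewrite !in_itv/= => ta; split; last first.
      by rewrite /p ?andbT; lra.
    by have := ABC _ _ At Bb; rewrite (_ : (_ + _) / 2 = t)//; lra.
  - exact: pre_affine.
  - move=> t /= [At]; rewrite !in_itv/= andbT => ta; split; last first.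
      by rewrite /p ?andbT; lra.
    by have := ABC _ _ Aa At; rewrite (_ : (_ + _) / 2 = t)//; lra.
(* Once [leb C] is finite, terms can be moved across the inequality and the two anchors are released
   one after the other. *)
have [Coo|Cfin] := eqVneq (leb C) +oo%E.
  by rewrite Coo gt0_muley ?leey// lte_fin.
have fC : leb C \is a fin_num by rewrite ge0_fin_numE ?measure_ge0// ltey.
have f2C : (2%:E * leb C)%E \is a fin_num by rewrite fin_numM.
have step b : B b -> (leb A + leb (B `&` [set` `]b, +oo[%R]) <= 2%:E * leb C)%E.
  move=> Bb; have [a0 Aa0] := A0.
  have fB : leb (B `&` [set` `]b, +oo[%R]) \is a fin_num.
    rewrite ge0_fin_numE ?measure_ge0//.
    apply: (@le_lt_trans _ _ (2%:E * leb C)%E); last by rewrite ltey_eq f2C.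
    apply: le_trans (key a0 b Aa0 Bb); apply: leeDr; exact: measure_ge0.
  rewrite -leeBrDr//; apply: lebesgue_sup_le => // a Aa.
  by rewrite leeBrDr//; exact: key.
have fA : leb A \is a fin_num.
  have [b0 Bb0] := B0.
  rewrite ge0_fin_numE ?measure_ge0//.
  apply: (@le_lt_trans _ _ (2%:E * leb C)%E); last by rewrite ltey_eq f2C.
  apply: le_trans (step b0 Bb0); apply: leeDl; exact: measure_ge0.
rewrite addeC -leeBrDr//; apply: lebesgue_sup_le_right => // b Bb.
by rewrite leeBrDr// addeC; exact: step.
Qed.

End brunn_minkowski1.

(** * From level sets to functions *)

Section prekopa_leindler1.
Context {R : realType}.
Local Notation leb := (@lebesgue_measure R).
Local Notation mR := (measurableTypeR R).

(** Distribution function of [f / c], cut off outside the unit interval: when [c] is the supremum of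
    [f], these are the levels at which the level set is non-empty, as [brunn_minkowski1] requires.
    For larger functions the cut-off turns [f / c] into its minimum with 1. *)
Definition layer (f : mR -> R) (c s : R) : \bar R :=
  if (0 < s < 1)%R then leb [set x | (c * s < f x)%R] else 0%E.

Section layer.
Variables (f : mR -> R) (c : R).
Hypotheses (mf : measurable_fun setT f) (f0 : forall x, (0 <= f x)%R) (c0 : (0 < c)%R).

Let S : set (mR * mR) := [set p | (0 < p.1 < 1)%R /\ (c * p.1 < f p.2)%R].

Let mS : measurable S.
Proof.
have -> : S = (fst @^-1` `]0%R, 1%R[) `&`
    ((fun p : mR * mR => f p.2 - c * p.1 : mR) @^-1` `]0%R, +oo[).
  by apply/seteqP; split => -[s x] /=; rewrite !in_itv/= andbT subr_gt0.
apply: measurableI.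
  by rewrite -[X in measurable X]setTI; exact: (measurable_fst).
rewrite -[X in measurable X]setTI.
have mg : measurable_fun setT (fun p : mR * mR => f p.2 - c * p.1 : mR).
  apply: measurable_funB; first exact: measurableT_comp mf measurable_snd.
  by apply: measurable_funM => //; exact: measurable_fst.
exact: mg.
Qed.

Let mindS : measurable_fun setT (fun p => (\1_S p)%:E : \bar R).
Proof. by apply/measurable_EFinP; exact: measurable_indic. Qed.

Let layerE s : layer f c s = (\int[leb]_x (\1_S (s, x))%:E)%E.
Proof.
rewrite /layer; case: ifPn => s01.
  rewrite (eq_integral (fun x => (\1_[set x | (c * s < f x)%R] x)%:E)); last first.
    move=> x _; rewrite !indicE; congr (_%:R%:E); congr nat_of_bool.
    by apply/idP/idP; rewrite !inE /S /= => // -[].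
  rewrite integral_indic ?setIT//.
  have mg : measurable_fun setT (fun x : mR => f x - c * s : mR).
    by apply: measurable_funB.
  have := mg measurableT `]0%R, +oo[%classic (measurable_itv _).
  rewrite setTI; congr measurable; apply/seteqP; split => x /=.
    by rewrite in_itv/= andbT subr_gt0.
  by rewrite in_itv/= andbT subr_gt0.
rewrite integral0_eq// => x _; rewrite indicE memNset// => -[].
by move: s01 => /negP.
Qed.

Lemma measurable_layer : measurable_fun setT (layer f c : mR -> \bar R).
Proof.
rewrite (_ : layer f c = fun s => (\int[leb]_x (\1_S (s, x))%:E)%E); last first.
  by apply/funext => s; exact: layerE.
by apply: (measurable_fun_fubini_tonelli_F _ mindS) => p; rewrite lee_fin.
Qed.

Lemma integral_layer :
  (\int[leb]_s layer f c s = \int[leb]_x (Num.min 1 (f x / c))%:E)%E.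
Proof.
under eq_integral do rewrite layerE.
rewrite (fubini_tonelli (fun p : mR * mR => (\1_S p)%:E))//.
apply: eq_integral => x _.
have fx0 : (0 <= Num.min 1 (f x / c))%R.
  by rewrite le_min ler01/= divr_ge0// ltW.
transitivity (\int[leb]_(s in setT) (\1_([set` `]0%R, (Num.min 1 (f x / c))%R[%R] : set mR) s)%:E)%E.
  apply: eq_integral => s _; rewrite !indicE; congr (_%:R%:E); congr nat_of_bool.
  apply/idP/idP; rewrite !inE /S /= in_itv/= lt_min ltr_pdivlMr// [(s * c)%R]mulrC.
    by move=> [/andP[-> ->] ->].
  by move=> /and3P[-> -> ->].
rewrite integral_indic ?setIT//.
by rewrite /= lebesgue_measure_itv/= lte_fin; case: ltP => [_|h]; rewrite ?sube0//;
  congr EFin; apply/eqP; rewrite eq_le fx0 h.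
Qed.

End layer.

(** Divide [f], [g] by their suprema [a], [b], and [h] by [c = sqrt (a b)]. Then the level sets of
    height [s < 1] satisfy the midpoint hypothesis and are non-empty, so [brunn_minkowski1] applies
    to each [s]. Integrating in [s] bounds the arithmetic mean of the normalised integrals, hence
    their geometric mean. *)
Lemma prekopa_leindler1_bounded (k : R) (f g h : mR -> R) :
  measurable_fun setT f -> measurable_fun setT g -> measurable_fun setT h ->
  (forall x, 0 <= f x <= k) -> (forall x, 0 <= g x <= k) -> (forall x, 0 <= h x) ->
  (forall x y, f x * g y <= h ((x + y) / 2) ^+ 2) ->
  (\int[leb]_x (f x)%:E * \int[leb]_x (g x)%:E <= (\int[leb]_x (h x)%:E) ^+ 2)%E.
Proof.
move=> mf mg mh fk gk h0 fgh.
have f0 x : 0 <= f x by case/andP: (fk x).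
have g0 x : 0 <= g x by case/andP: (gk x).
have sup_prop (u : mR -> R) : (forall x, 0 <= u x <= k) ->
    (forall x, u x = 0) \/ exists2 c, 0 < c &
      (forall x, u x <= c) /\ (forall s, 0 < s < 1 -> exists x, c * s < u x).
  move=> uk; pose c := sup (range u).
  have su : has_sup (range u).
    by split; [exists (u 0); exists 0|exists k => _ [x _ <-]; case/andP: (uk x)].
  have uc x : u x <= c by apply: ub_le_sup; [exact: su.2|exists x].
  have := uc 0; have u0 : 0 <= u 0 by case/andP: (uk 0).
  move=> /(le_trans u0); rewrite le_eqVlt => /orP[/eqP c0|c0].
    left=> x; apply/eqP; rewrite eq_le; case/andP: (uk x) => -> _.
    by rewrite c0 uc.
  right; exists c => //; split=> // s /andP[s0 s1].
  have [|_ [x _ <-]] := @sup_adherent _ (range u) (c * (1 - s)) _ su.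
    by rewrite mulr_gt0// subr_gt0.
  by rewrite -/c mulrBr mulr1 subKr => h'; exists x.
have sqge0 (x : \bar R) : (0 <= x)%E -> (0 <= x ^+ 2)%E by move=> x0; exact: mule_ge0.
have If0 : (0 <= \int[leb]_x (f x)%:E)%E by apply: integral_ge0 => x _; rewrite lee_fin.
have Ig0 : (0 <= \int[leb]_x (g x)%:E)%E by apply: integral_ge0 => x _; rewrite lee_fin.
have Ih0 : (0 <= \int[leb]_x (h x)%:E)%E by apply: integral_ge0 => x _; rewrite lee_fin.
have [fz|[a a0 [fa fas]]] := sup_prop f fk.
  rewrite (_ : (\int[leb]_x (f x)%:E)%E = 0%E) ?mul0e ?sqge0//.
  by rewrite integral0_eq// => x _; rewrite fz.
have [gz|[b b0 [gb gbs]]] := sup_prop g gk.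
  rewrite (_ : (\int[leb]_x (g x)%:E)%E = 0%E) ?mule0 ?sqge0//.
  by rewrite integral0_eq// => x _; rewrite gz.
pose c := Num.sqrt (a * b).
have ab0 : 0 < a * b by rewrite mulr_gt0.
have c0 : 0 < c by rewrite sqrtr_gt0.
have c2 : c ^+ 2 = a * b by rewrite sqr_sqrtr// ltW.
have mset (u : mR -> R) d : measurable_fun setT u -> measurable [set x | d < u x].
  move=> mu; have := mu measurableT `]d, +oo[%classic (measurable_itv _).
  rewrite setTI; congr measurable; apply/seteqP; split => x /=.
    by rewrite in_itv/= andbT.
  by rewrite in_itv/= andbT.
have layer_ineq s : (layer f a s + layer g b s <= 2%:E * layer h c s)%E.
  rewrite /layer; case: ifPn => [s01|_]; last by rewrite adde0 mule0.
  apply: brunn_minkowski1; [exact: mset|exact: mset|exact: mset|exact: fas|exact: gbs|].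
  move=> x y /= fx gy.
  have s0 : 0 < s by case/andP: s01.
  rewrite -ltr_sqr ?nnegrE//; last by rewrite mulr_ge0// ltW.
  apply: lt_le_trans (fgh x y).
  rewrite exprMn c2 (_ : a * b * s ^+ 2 = (a * s) * (b * s)); last by lra.
  by rewrite ltr_pM// mulr_ge0// ltW.
have layer_int (u : mR -> R) d : measurable_fun setT u -> (forall x, 0 <= u x) ->
    0 < d -> (forall x, u x <= d) ->
    (\int[leb]_s layer u d s = d^-1%:E * \int[leb]_x (u x)%:E)%E.
  move=> mu u0 d0 ud; rewrite integral_layer// -ge0_integralZl//; last 3 first.
  - by apply/measurable_EFinP.
  - by move=> x _; rewrite lee_fin.
  - by rewrite lee_fin invr_ge0 ltW.
  apply: eq_integral => x _; rewrite -EFinM [(d^-1 * _)%R]mulrC; congr EFin.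
  by apply/min_idPr; rewrite ler_pdivrMr// mul1r.
have layer0 (u : mR -> R) d s : (0 <= layer u d s)%E.
  by rewrite /layer; case: ifP => // _; exact: measure_ge0.
have main : (a^-1%:E * \int[leb]_x (f x)%:E + b^-1%:E * \int[leb]_x (g x)%:E
    <= (2 / c)%:E * \int[leb]_x (h x)%:E)%E.
  rewrite -!layer_int// -ge0_integralD//; last 2 first.
  - exact: measurable_layer.
  - exact: measurable_layer.
  apply: (@le_trans _ _ (\int[leb]_s (2%:E * layer h c s))%E).
    apply: ge0_le_integral => //.
    - by move=> x _; rewrite adde_ge0.
    - by apply: emeasurable_funD; exact: measurable_layer.
    - by apply: measurable_funeM; exact: measurable_layer.
  rewrite ge0_integralZl//; last exact: measurable_layer.
  rewrite integral_layer// EFinM -muleA; apply: lee_wpmul2l => //.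
  rewrite -ge0_integralZl//; last 3 first.
  - by apply/measurable_EFinP.
  - by move=> x _; rewrite lee_fin.
  - by rewrite lee_fin invr_ge0 ltW.
  apply: ge0_le_integral => //.
  - by move=> x _; rewrite lee_fin le_min ler01 divr_ge0// ltW.
  - apply/measurable_EFinP; apply: measurable_minr => //.
    exact: measurable_funM.
  - by apply: measurable_funeM; apply/measurable_EFinP.
  - by move=> x _; rewrite -EFinM lee_fin ge_min mulrC lexx orbT.
have [Hoo|Hfin] := eqVneq (\int[leb]_x (h x)%:E)%E +oo%E.
  by rewrite Hoo expe2 mulyy leey.
have fH : (\int[leb]_x (h x)%:E)%E \is a fin_num by rewrite ge0_fin_numE// ltey.
have rhs_fin : ((2 / c)%:E * \int[leb]_x (h x)%:E)%E \is a fin_num by rewrite fin_numM.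
have finp (u : mR -> R) d : 0 < d -> (0 <= \int[leb]_x (u x)%:E)%E ->
    (d^-1%:E * \int[leb]_x (u x)%:E <= (2 / c)%:E * \int[leb]_x (h x)%:E)%E ->
    (\int[leb]_x (u x)%:E)%E \is a fin_num.
  move=> d0 u0 le; rewrite ge0_fin_numE// ltey; apply/negP => /eqP uoo.
  move: le; rewrite uoo gt0_muley ?lte_fin ?invr_gt0//.
  by rewrite leye_eq => /eqP ee; move: rhs_fin; rewrite ee.
have ffin : (\int[leb]_x (f x)%:E)%E \is a fin_num.
  apply: (finp f a) => //; apply: le_trans main; apply: leeDl.
  by rewrite mule_ge0// lee_fin invr_ge0 ltW.
have gfin : (\int[leb]_x (g x)%:E)%E \is a fin_num.
  apply: (finp g b) => //; apply: le_trans main; apply: leeDr.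
  by rewrite mule_ge0// lee_fin invr_ge0 ltW.
move: main If0 Ig0 Ih0.
rewrite -(fineK fH) -(fineK ffin) -(fineK gfin).
move: (fine _) (fine _) (fine _) => H B A.
rewrite -!EFinM -EFinD !lee_fin => main A0 B0 H0.
have AB : (A / a) * (B / b) <= (H / c) ^+ 2.
  have : A / a + B / b <= 2 * (H / c).
    by rewrite [H / c]mulrC mulrA [A / a]mulrC [B / b]mulrC.
  have : 0 <= A / a by rewrite divr_ge0// ltW.
  have : 0 <= B / b by rewrite divr_ge0// ltW.
  move: (A / a) (B / b) (H / c) => p q r q0 p0 pqr.
  have : (p + q) ^+ 2 <= (2 * r) ^+ 2 by rewrite ler_sqr// nnegrE; lra.
  by have := sqr_ge0 (p - q); rewrite sqrrB sqrrD exprMn; lra.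
by move: AB; rewrite mulf_div expr_div_n c2 ler_pM2r ?invr_gt0.
Qed.

End prekopa_leindler1.

Section prekopa_leindler.
Context {R : realType}.
Local Open Scope ereal_scope.
Local Notation leb := (@lebesgue_measure R).
Local Notation mR := (measurableTypeR R).

(** Extended multiplication is not continuous at [0 * +oo]. When [a] is infinite, one non-zero [u k]
    already forces [M] to be infinite, and otherwise the limit is 0. *)
Lemma mule_lim_le (a U M : \bar R) (u : nat -> \bar R) : 0 <= a ->
  (forall k, 0 <= u k) -> u @ \oo --> U -> (forall k, a * u k <= M) -> a * U <= M.
Proof.
move=> a0 u0 uU H.
have U0 : 0 <= U by apply: (cvge_ge _ uU); apply: nearW.
case: a => [a||] in a0 H *; last by [].
  have cau : (fun k => a%:E * u k) @ \oo --> a%:E * U by exact: cvgeZl.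
  by apply: (cvge_le _ cau); apply: nearW.
have [->|Un0] := eqVneq U 0.
  rewrite mule0; apply: le_trans (H 0%N); exact: mule_ge0.
have [[k uk]|] := pselect (exists k, u k != 0).
  have := H k; rewrite gt0_mulye ?lt0e ?uk ?u0// leye_eq => /eqP ->.
  exact: leey.
move=> nk; have : U = 0; last by move/eqP: Un0.
have uz : u = fun=> 0.
  by apply/funext => k; apply/eqP/negP => /negP uk; apply: nk; exists k.
by rewrite uz in uU; exact: (cvg_unique _ uU (cvg_cst _)).
Qed.

Lemma integral_truncate (f : mR -> \bar R) : measurable_fun setT f ->
  (forall x, 0 <= f x) ->
  (fun k => \int[leb]_x (mine (f x) k%:R%:E)) @ \oo --> \int[leb]_x f x.
Proof.
move=> mf f0.
rewrite [X in _ --> X](_ : _ = \int[leb]_x (limn (fun k => mine (f x) k%:R%:E))); last first.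
  apply: eq_integral => x _; apply/esym/cvg_lim => //.
  have := f0 x; case: (f x) => [r||//] r0.
    apply: cvg_near_cst; near=> k.
    apply/min_idPl; rewrite lee_fin; near: k; exact: nbhs_infty_ger.
  rewrite (_ : (fun k => _) = (fun k => k%:R%:E)); last first.
    by apply/funext => k; apply/min_idPr; exact: leey.
  by apply/cvgeryP; exact: cvgr_idn.
apply: cvg_monotone_convergence => //.
- by move=> k; apply: measurable_mine.
- by move=> k x _; rewrite le_min f0 lee_fin ler0n.
- move=> x _ k l kl; rewrite le_min ge_min lexx/= ge_min lee_fin ler_nat kl.
  by rewrite orbT.
Unshelve. all: by end_near. Qed.

(** Truncating all three functions at one level preserves the hypothesis. By monotonicity the bound
    extends to two different levels on the left, which then tend to infinity separately. *)
Lemma prekopa_leindler1 (f g h : mR -> \bar R) :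
  measurable_fun setT f -> measurable_fun setT g -> measurable_fun setT h ->
  (forall x, 0 <= f x) -> (forall x, 0 <= g x) -> (forall x, 0 <= h x) ->
  (forall x y, f x * g y <= h ((x + y) / 2)%R ^+ 2) ->
  \int[leb]_x f x * \int[leb]_x g x <= (\int[leb]_x h x) ^+ 2.
Proof.
move=> mf mg mh f0 g0 h0 fgh.
pose tr (u : mR -> \bar R) k x := mine (u x) k%:R%:E.
have tr0 u k x : 0 <= u x -> 0 <= tr u k x.
  by move=> u0; rewrite le_min u0 lee_fin ler0n.
have trfin u k x : 0 <= u x -> tr u k x \is a fin_num.
  move=> u0; rewrite ge0_fin_numE ?tr0// /tr gt_min ltry orbT//.
have mtr u k : measurable_fun setT u -> measurable_fun setT (tr u k : mR -> \bar R).
  by move=> mu; apply: measurable_mine.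
have step k : \int[leb]_x tr f k x * \int[leb]_x tr g k x <= (\int[leb]_x h x) ^+ 2.
  have fineE u : (forall x, 0 <= u x) ->
      \int[leb]_x tr u k x = \int[leb]_x (fine (tr u k x))%:E.
    by move=> u0; apply: eq_integral => x _; rewrite fineK// trfin.
  have fk u x : 0 <= u x -> (0 <= fine (tr u k x) <= k%:R)%R.
    move=> u0; rewrite fine_ge0 ?tr0//= -lee_fin fineK ?trfin//.
    by rewrite ge_min lexx orbT.
  apply: (@le_trans _ _ ((\int[leb]_x tr h k x) ^+ 2)).
    rewrite !fineE//; apply: (@prekopa_leindler1_bounded _ k%:R).
    - by apply: measurableT_comp => //; exact: mtr.
    - by apply: measurableT_comp => //; exact: mtr.
    - by apply: measurableT_comp => //; exact: mtr.
    - by move=> x; exact: fk.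
    - by move=> x; exact: fk.
    - by move=> x; apply: fine_ge0; exact: tr0.
    move=> x y; rewrite -lee_fin EFinM EFin_expe !fineK ?trfin//.
    rewrite {3}/tr; case: (leP (h ((x + y) / 2)%R) k%:R%:E) => _; last first.
      by rewrite lee_pmul ?tr0// /tr ge_min lexx orbT.
    by apply: le_trans (fgh x y); rewrite lee_pmul ?tr0// /tr ge_min lexx.
  rewrite !expe2; apply: lee_pmul.
  - by apply: integral_ge0 => x _; exact: tr0.
  - by apply: integral_ge0 => x _; exact: tr0.
  - apply: ge0_le_integral => //.
    + by move=> x _; exact: tr0.
    + exact: mtr.
    + by move=> x _; rewrite ge_min lexx.
  - apply: ge0_le_integral => //.
    + by move=> x _; exact: tr0.
    + exact: mtr.
    + by move=> x _; rewrite ge_min lexx.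
have trI0 u k : (forall x, 0 <= u x) -> 0 <= \int[leb]_x tr u k x.
  by move=> u0; apply: integral_ge0 => x _; exact: tr0.
have trS u k l : measurable_fun setT u -> (forall x, 0 <= u x) -> (k <= l)%N ->
    \int[leb]_x tr u k x <= \int[leb]_x tr u l x.
  move=> mu u0 kl; apply: ge0_le_integral => //.
  - by move=> x _; exact: tr0.
  - exact: mtr.
  - exact: mtr.
  - move=> x _; rewrite le_min ge_min lexx/= ge_min lee_fin ler_nat kl.
    by rewrite orbT.
have step2 k l : \int[leb]_x tr f k x * \int[leb]_x tr g l x <= (\int[leb]_x h x) ^+ 2.
  apply: le_trans (step (maxn k l)); apply: lee_pmul; rewrite ?trI0//.
  - by apply: trS => //; exact: leq_maxl.
  - by apply: trS => //; exact: leq_maxr.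
have step3 k : \int[leb]_x tr f k x * \int[leb]_x g x <= (\int[leb]_x h x) ^+ 2.
  apply: (mule_lim_le (u := fun l => \int[leb]_x tr g l x)) => //.
  - exact: trI0.
  - by move=> l; exact: trI0.
  - exact: integral_truncate.
rewrite muleC; apply: (mule_lim_le (u := fun l => \int[leb]_x tr f l x)) => //.
- exact: integral_ge0.
- by move=> l; exact: trI0.
- exact: integral_truncate.
- by move=> l; rewrite muleC.
Qed.

(** The sections at [s], [t] and their midpoint satisfy the hypothesis in dimension [n], so the
    section integrals satisfy it on the line. *)
Lemma prekopa_leindler n (f g h : 'rV[R]_n -> \bar R) :
  measurable_fun setT f -> measurable_fun setT g -> measurable_fun setT h ->
  (forall x, 0 <= f x) -> (forall x, 0 <= g x) -> (forall x, 0 <= h x) ->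
  (forall x y, f x * g y <= h (2^-1 *: (x + y))%R ^+ 2) ->
  \int[lebesgue_rV R n]_x f x * \int[lebesgue_rV R n]_x g x <= (\int[lebesgue_rV R n]_x h x) ^+ 2.
Proof.
elim: n f g h => [|n IH] f g h mf mg mh f0 g0 h0 fgh.
  rewrite !integral_lebesgue_rV0//; apply: le_trans (fgh _ _) _.
  by rewrite addr0 scaler0.
have mv (u : 'rV[R]_n.+1 -> \bar R) t : measurable_fun setT u ->
    measurable_fun setT (fun x : 'rV[R]_n => u (vcons t x)).
  by move=> mu; apply: measurableT_comp => //; exact: measurable_vcons_fun.
rewrite (integral_lebesgue_rVS mf f0) (integral_lebesgue_rVS mg g0) (integral_lebesgue_rVS mh h0).
apply: (@prekopa_leindler1 (fun t => \int[lebesgue_rV R n]_x f (vcons t x))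
  (fun t => \int[lebesgue_rV R n]_x g (vcons t x)) (fun t => \int[lebesgue_rV R n]_x h (vcons t x))).
- exact: measurable_integral_vcons.
- exact: measurable_integral_vcons.
- exact: measurable_integral_vcons.
- by move=> t; exact: integral_ge0.
- by move=> t; exact: integral_ge0.
- by move=> t; exact: integral_ge0.
move=> s t; apply: IH => //; [exact: mv|exact: mv|exact: mv|].
move=> x y; apply: le_trans (fgh _ _) _.
by rewrite vconsD vconsZ mulrC.
Qed.

End prekopa_leindler.

(** * Doubling: midpoint and difference variables *)

Section midpoint.
Context {R : realType} {n : nat}.
Local Open Scope ereal_scope.
Local Notation V := 'rV[R]_n.
Local Notation mu := (lebesgue_rV R n).

Lemma measurable_section1 (H : V * V -> \bar R) y :
  measurable_fun setT H -> measurable_fun setT (fun x => H (x, y)).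
Proof. by move=> mH; apply: measurableT_comp => //; exact: measurable_fun_pair. Qed.

Lemma measurable_section2 (H : V * V -> \bar R) x :
  measurable_fun setT H -> measurable_fun setT (fun y => H (x, y)).
Proof. by move=> mH; apply: measurableT_comp => //; exact: measurable_fun_pair. Qed.

Lemma fubini_lebesgue_rV (H : V * V -> \bar R) :
  measurable_fun setT H -> (forall p, 0 <= H p) ->
  \int[mu]_x \int[mu]_y H (x, y) = \int[mu]_y \int[mu]_x H (x, y).
Proof. by move=> mH H0; apply: fubini_tonelli. Qed.

(** The change of variables preserves measure. It is factored as [x = y + d] at fixed [y], then
    [y = m - d/2] at fixed [d], so that Tonelli and translation invariance suffice. *)
Lemma integral_midpoint (H : V * V -> \bar R) :
  measurable_fun setT H -> (forall p, 0 <= H p) ->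
  \int[mu]_x \int[mu]_y H (x, y) =
  \int[mu]_m \int[mu]_d H (m + 2^-1 *: d, m - 2^-1 *: d)%R.
Proof.
move=> mH H0.
have mpair d (T : measurableType d) (f g : T -> V) : measurable_fun setT f ->
    measurable_fun setT g -> measurable_fun setT (fun t => H (f t, g t)).
  by move=> mf mg; apply: measurableT_comp => //; exact: measurable_fun_pair.
have mfst : measurable_fun setT (fst : V * V -> V) by exact: measurable_fst.
have msnd : measurable_fun setT (snd : V * V -> V) by exact: measurable_snd.
rewrite (fubini_lebesgue_rV mH H0).
transitivity (\int[mu]_y \int[mu]_d H (y + d, y)%R).
  apply: eq_integral => y _.
  rewrite -[LHS]mul1e -[X in X * _](_ : ((`|1|^-1) ^+ n)%:E = 1); last first.
    by rewrite normr1 invr1 expr1n.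
  rewrite -(@ge0_integral_affine R n 1%R y (fun x => H (x, y)))//; last first.
    exact: measurable_section1.
  by apply: eq_integral => d _; rewrite scale1r addrC.
have mH1 : measurable_fun setT (fun p : V * V => H (p.1 + p.2, p.1)%R).
  by apply: mpair => //; exact: measurable_rvD.
rewrite (fubini_lebesgue_rV mH1 (fun p => H0 _))/=.
have mH2 : measurable_fun setT (fun p : V * V =>
    H (p.1 + 2^-1 *: p.2, p.1 - 2^-1 *: p.2)%R).
  apply: mpair; first by apply: measurable_rvD => //; exact: measurable_rvZ.
  by apply: measurable_rvB => //; exact: measurable_rvZ.
rewrite [RHS](fubini_lebesgue_rV mH2 (fun p => H0 _))/=.
apply: eq_integral => d _.
rewrite -[LHS]mul1e -[X in X * _](_ : ((`|1|^-1) ^+ n)%:E = 1); last first.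
  by rewrite normr1 invr1 expr1n.
rewrite -(@ge0_integral_affine R n 1%R (- (2^-1 *: d))%R (fun y => H (y + d, y)%R))//; last first.
  by apply: mpair => //; apply: measurable_rvD.
apply: eq_integral => m _; rewrite scale1r; congr (H (_, _)).
rewrite -addrA; congr (_ + _)%R.
by rewrite -{2}[d]scale1r -scaleNr -scalerDl; congr (_ *: _)%R; lra.
Qed.

Lemma lee_sqr_ge0 (x y : \bar R) : 0 <= x -> 0 <= y -> x ^+ 2 <= y ^+ 2 -> x <= y.
Proof.
move=> x0 y0; rewrite !expe2; case: (leP x y) => // yx.
have fy : y \is a fin_num.
  by rewrite ge0_fin_numE//; exact: lt_le_trans yx (leey _).
case: x => [x||] in x0 yx *; last by [].
  move: y0 yx; rewrite -(fineK fy) lte_fin -!EFinM !lee_fin => y0 yx.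
  by rewrite !leNgt ltr_pM// yx.
by rewrite mulyy leye_eq -(fineK fy) -EFinM.
Qed.

(* For fixed midpoint m, Prekopa-Leindler is applied to the slice
   d |-> f1 (m + d/2) * f2 (m - d/2) and to its reflection. *)
Lemma doubling (f1 f2 : V -> \bar R) (H : V * V -> \bar R) :
  measurable_fun setT f1 -> measurable_fun setT f2 -> measurable_fun setT H ->
  (forall x, 0 <= f1 x) -> (forall x, 0 <= f2 x) -> (forall p, 0 <= H p) ->
  (forall m d1 d2 : V, let e := (2^-1 *: (d1 + d2))%R in
     (f1 (m + 2^-1 *: d1)%R * f2 (m - 2^-1 *: d1)%R) *
     (f1 (m - 2^-1 *: d2)%R * f2 (m + 2^-1 *: d2)%R)
     <= H (m + 2^-1 *: e, m - 2^-1 *: e)%R ^+ 2) ->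
  \int[mu]_x f1 x * \int[mu]_x f2 x <= \int[mu]_x \int[mu]_y H (x, y).
Proof.
move=> mf1 mf2 mH f10 f20 H0 Hle.
have mfst : measurable_fun setT (fst : V * V -> V) by exact: measurable_fst.
have msnd : measurable_fun setT (snd : V * V -> V) by exact: measurable_snd.
pose G (p : V * V) := f1 p.1 * f2 p.2.
have mG : measurable_fun setT G.
  by apply: emeasurable_funM; exact: measurableT_comp.
have G0 p : 0 <= G p by exact: mule_ge0.
have mpair (K : V * V -> \bar R) d (T : measurableType d) (f g : T -> V) :
    measurable_fun setT K -> measurable_fun setT f ->
    measurable_fun setT g -> measurable_fun setT (fun t => K (f t, g t)).
  by move=> mK mf mg; apply: measurableT_comp => //; exact: measurable_fun_pair.
have -> : \int[mu]_x f1 x * \int[mu]_x f2 x = \int[mu]_x \int[mu]_y G (x, y).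
  rewrite -ge0_integralZr//; last exact: integral_ge0.
  by apply: eq_integral => x _; rewrite -ge0_integralZl.
rewrite !integral_midpoint//.
have msl (K : V * V -> \bar R) : measurable_fun setT K ->
    measurable_fun setT (fun p : V * V =>
      K (p.1 + 2^-1 *: p.2, p.1 - 2^-1 *: p.2)%R).
  move=> mK; apply: mpair => //.
    by apply: measurable_rvD => //; exact: measurable_rvZ.
  by apply: measurable_rvB => //; exact: measurable_rvZ.
apply: ge0_le_integral => //.
- by move=> m _; exact: integral_ge0.
- apply: (measurable_fun_fubini_tonelli_F _ (msl _ mG)) => p; exact: G0.
- apply: (measurable_fun_fubini_tonelli_F _ (msl _ mH)) => p; exact: H0.
move=> m _.
pose u d := G (m + 2^-1 *: d, m - 2^-1 *: d)%R.
pose v d := G (m - 2^-1 *: d, m + 2^-1 *: d)%R.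
have mZ : measurable_fun setT (fun d : V => 2^-1 *: d)%R by exact: measurable_rvZ.
have mp : measurable_fun setT (fun d : V => m + 2^-1 *: d)%R by exact: measurable_rvD.
have mm : measurable_fun setT (fun d : V => m - 2^-1 *: d)%R by exact: measurable_rvB.
have mU : measurable_fun setT u by exact: mpair.
have mV : measurable_fun setT v by exact: mpair.
apply: lee_sqr_ge0; [exact: integral_ge0|exact: integral_ge0|].
have -> : (\int[mu]_d u d) ^+ 2 = \int[mu]_d u d * \int[mu]_d v d.
  rewrite expe2; congr (_ * _).
  rewrite -[LHS]mul1e -[X in X * _](_ : ((`|-1|^-1) ^+ n)%:E = 1); last first.
    by rewrite normrN1 invr1 expr1n.
  rewrite -(@ge0_integral_affine R n (-1)%R 0%R u)//; last by move=> x; exact: G0.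
  apply: eq_integral => d _; by rewrite /u /v addr0 scaleN1r scalerN opprK.
apply: (@prekopa_leindler R n u v (fun e => H (m + 2^-1 *: e, m - 2^-1 *: e)%R)) => //.
- exact: mpair.
- by move=> x; exact: G0.
- by move=> x; exact: G0.
- by move=> d1 d2; exact: Hle.
Qed.

End midpoint.

Lemma ge0_integral_opp {R : realType} n (f : 'rV[R]_n -> \bar R) :
  measurable_fun setT f -> (forall x, 0 <= f x)%E ->
  (\int[lebesgue_rV R n]_x f (- x)%R = \int[lebesgue_rV R n]_x f x)%E.
Proof.
move=> mf f0.
rewrite -[RHS]mul1e -[X in (X * _)%E](_ : ((`|-1|^-1) ^+ n)%:E = 1%E); last first.
  by rewrite normrN1 invr1 expr1n.
rewrite -(@ge0_integral_affine R n (-1)%R 0%R f)//.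
by apply: eq_integral => y _; rewrite scaleN1r addr0.
Qed.

(** * Gaussian integrals over interpolated sets *)

Section gaussian_weight.
Context {R : realType} {n : nat}.
Local Notation V := 'rV[R]_n.
Local Notation mu := (lebesgue_rV R n).

Definition nrm2 (x : V) : R := \sum_i x ord0 i ^+ 2.
Definition dotp (x y : V) : R := \sum_i x ord0 i * y ord0 i.
Definition gwt (q : R) (x : V) : R := expR (- (q / 2) * nrm2 x).
Definition gint (q : R) (K : set V) : \bar R :=
  (\int[mu]_x (\1_K x * gwt q x)%:E)%E.

Lemma indic_in (K : set V) x : K x -> \1_K x = 1 :> R.
Proof. by move=> Kx; rewrite indicE mem_set. Qed.

Lemma indic_notin (K : set V) x : ~ K x -> \1_K x = 0 :> R.
Proof. by move=> Kx; rewrite indicE memNset. Qed.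

Lemma nrm2_ge0 x : 0 <= nrm2 x.
Proof. by apply: sumr_ge0 => i _; exact: sqr_ge0. Qed.

Lemma nrm2N x : nrm2 (- x) = nrm2 x.
Proof. by apply: eq_bigr => i _; rewrite mxE sqrrN. Qed.

Lemma nrm2Z c x : nrm2 (c *: x) = c ^+ 2 * nrm2 x.
Proof. by rewrite /nrm2 mulr_sumr; apply: eq_bigr => i _; rewrite mxE exprMn. Qed.

Lemma dotpN x y : dotp x (- y) = - dotp x y.
Proof. by rewrite /dotp -sumrN; apply: eq_bigr => i _; rewrite mxE mulrN. Qed.

Lemma gwt_ge0 q x : 0 <= gwt q x. Proof. exact: expR_ge0. Qed.

Lemma measurable_sum_coord d (T : measurableType d) (f : 'I_n -> T -> R) :
  (forall i, measurable_fun setT (f i : T -> measurableTypeR R)) ->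
  measurable_fun setT (fun t => \sum_i f i t : measurableTypeR R).
Proof.
move=> mf; pose I := index_enum 'I_n.
suff : measurable_fun setT (fun t => \sum_(i <- I) f i t : measurableTypeR R) by [].
elim: I => [|i I IH].
  by under eq_fun do rewrite big_nil; exact: measurable_cst.
under eq_fun do rewrite big_cons.
by apply: measurable_funD; [exact: mf|exact: IH].
Qed.

Lemma measurable_nrm2 d (T : measurableType d) (f : T -> V) :
  measurable_fun setT f -> measurable_fun setT (fun t => nrm2 (f t) : measurableTypeR R).
Proof.
move=> mf; apply: measurable_sum_coord => i.
apply: (@measurable_funX _ _ R setT (fun t => f t ord0 i) 2).
exact: measurable_rv_fun.
Qed.

Lemma measurable_dotp d (T : measurableType d) (f g : T -> V) :
  measurable_fun setT f -> measurable_fun setT g ->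
  measurable_fun setT (fun t => dotp (f t) (g t) : measurableTypeR R).
Proof.
move=> mf mg; apply: measurable_sum_coord => i.
by apply: measurable_funM; exact: measurable_rv_fun.
Qed.

Lemma measurable_gwt q : measurable_fun setT (gwt q : V -> measurableTypeR R).
Proof.
apply: measurableT_comp => //; apply: measurable_funM => //.
exact: measurable_nrm2.
Qed.

Lemma measurable_gint_fun q K : measurable K ->
  measurable_fun setT (fun x : V => (\1_K x * gwt q x)%:E).
Proof.
move=> mK; apply/measurable_EFinP; apply: measurable_funM.
  exact: measurable_indic.
exact: measurable_gwt.
Qed.

Lemma gint_ge0 q K : (0 <= gint q K)%E.
Proof. by apply: integral_ge0 => x _; rewrite lee_fin mulr_ge0 ?gwt_ge0. Qed.

(* The right-hand side is minimal in [d1 - d2] when the square displayed at the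
   end of the proof vanishes; [P1] and [P2] are the resulting weights of
   [(x - y) ^+ 2] and [(x + y) ^+ 2]. *)
Lemma midpoint_quadratic (A B P1 P2 a c m d1 d2 : R) : 0 < A -> 0 < B ->
  P1 = (A + B) / 4 -> P2 * (A + B) = A * B -> a <= P1 + P2 -> c = P1 - P2 ->
  let e := 2^-1 * (d1 + d2) in
  let x := m + 2^-1 * e in let y := m - 2^-1 * e in
  2 * (a * (x ^+ 2 + y ^+ 2) - 2 * c * (x * y)) <=
  A * ((m + 2^-1 * d1) ^+ 2 + (m - 2^-1 * d2) ^+ 2) +
  B * ((m - 2^-1 * d1) ^+ 2 + (m + 2^-1 * d2) ^+ 2).
Proof.
move=> A0 B0 P1E P2E aP cE /=; set e := 2^-1 * (d1 + d2).
set x := m + 2^-1 * e; set y := m - 2^-1 * e.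
have xy0 : 0 <= x ^+ 2 + y ^+ 2 by rewrite addr_ge0 ?sqr_ge0.
have h1 : a * (x ^+ 2 + y ^+ 2) - 2 * c * (x * y) <=
    P1 * (x - y) ^+ 2 + P2 * (x + y) ^+ 2.
  apply: (@le_trans _ _ ((P1 + P2) * (x ^+ 2 + y ^+ 2) - 2 * c * (x * y))).
    by rewrite lerD2r; apply: ler_wpM2r.
  by rewrite cE le_eqVlt; apply/orP; left; apply/eqP; ring.
apply: (@le_trans _ _ (2 * (P1 * (x - y) ^+ 2 + P2 * (x + y) ^+ 2))).
  by rewrite ler_pM2l.
have AB0 : 0 < A + B by rewrite addr_gt0.
have P2E' : P2 = A * B / (A + B) by rewrite -P2E mulfK// gt_eqF.
rewrite -subr_ge0.
suff -> : A * ((m + 2^-1 * d1) ^+ 2 + (m - 2^-1 * d2) ^+ 2) +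
    B * ((m - 2^-1 * d1) ^+ 2 + (m + 2^-1 * d2) ^+ 2) -
    2 * (P1 * (x - y) ^+ 2 + P2 * (x + y) ^+ 2) =
    2 * ((A + B) * ((d1 - d2) / 4) + (A - B) * m) ^+ 2 / (A + B).
  by apply: divr_ge0 (ltW AB0); rewrite mulr_ge0// sqr_ge0.
by rewrite P1E P2E' /x /y /e; field; rewrite gt_eqF.
Qed.

Definition pair_weight (a c : R) (K : set V) (p : V * V) : R :=
  \1_K p.1 * \1_K p.2 * expR (- (a / 2) * (nrm2 p.1 + nrm2 p.2) + c * dotp p.1 p.2).

Lemma pair_weight_ge0 a c K p : 0 <= pair_weight a c K p.
Proof. by rewrite mulr_ge0 ?expR_ge0. Qed.

Lemma measurable_pair_weight a c K : measurable K ->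
  measurable_fun setT (fun p => (pair_weight a c K p)%:E).
Proof.
move=> mK; apply/measurable_EFinP; apply: measurable_funM.
  apply: measurable_funM; apply: measurableT_comp => //; exact: measurable_indic.
apply: measurableT_comp => //; apply: measurable_funD.
  apply: measurable_funM => //.
  by apply: measurable_funD; apply: measurable_nrm2.
by apply: measurable_funM => //; exact: measurable_dotp.
Qed.

Lemma gint_doubling (A B P1 P2 a c : R) (K1 K2 K : set V) : 0 < A -> 0 < B ->
  P1 = (A + B) / 4 -> P2 * (A + B) = A * B -> a <= P1 + P2 -> c = P1 - P2 ->
  measurable K1 -> measurable K2 -> measurable K ->
  (forall x y, K1 x -> K2 y -> K (2^-1 *: (x + y))) ->
  (gint A K1 * gint B K2 <=
   \int[mu]_x \int[mu]_y (pair_weight a c K (x, y))%:E)%E.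
Proof.
move=> A0 B0 P1E P2E aP cE mK1 mK2 mK K12.
apply: (doubling (H := fun p => (pair_weight a c K p)%:E)).
- exact: measurable_gint_fun.
- exact: measurable_gint_fun.
- exact: measurable_pair_weight.
- by move=> x; rewrite lee_fin mulr_ge0 ?gwt_ge0.
- by move=> x; rewrite lee_fin mulr_ge0 ?gwt_ge0.
- by move=> p; rewrite lee_fin pair_weight_ge0.
move=> m d1 d2 /=; set e := 2^-1 *: (d1 + d2); rewrite -!EFinM lee_fin -expr2.
rewrite [X in X <= _](_ : _ =
  (\1_K1 (m + 2^-1 *: d1) * \1_K2 (m - 2^-1 *: d1)
   * (\1_K1 (m - 2^-1 *: d2) * \1_K2 (m + 2^-1 *: d2))) *
  (gwt A (m + 2^-1 *: d1) * gwt B (m - 2^-1 *: d1)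
   * (gwt A (m - 2^-1 *: d2) * gwt B (m + 2^-1 *: d2)))); last by ring.
have W0 x : 0 <= gwt A x by exact: gwt_ge0.
have [K1a|K1a] := pselect (K1 (m + 2^-1 *: d1)); last first.
  by rewrite (indic_notin K1a) !mul0r sqr_ge0.
have [K2a|K2a] := pselect (K2 (m - 2^-1 *: d1)); last first.
  by rewrite (indic_notin K2a) mulr0 !mul0r sqr_ge0.
have [K1b|K1b] := pselect (K1 (m - 2^-1 *: d2)); last first.
  by rewrite (indic_notin K1b) mul0r mulr0 mul0r sqr_ge0.
have [K2b|K2b] := pselect (K2 (m + 2^-1 *: d2)); last first.
  by rewrite (indic_notin K2b) !mulr0 mul0r sqr_ge0.
(* The reflected slice pairs points crosswise: [m + e/2] is the midpoint of [m + d1/2] in [K1] and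
   [m + d2/2] in [K2], and [m - e/2] that of [m - d2/2] in [K1] and [m - d1/2] in [K2]. *)
have Kx : K (m + 2^-1 *: e).
  have := K12 _ _ K1a K2b; congr K; apply/rowP => i.
  by rewrite /e !mxE; field.
have Ky : K (m - 2^-1 *: e).
  have := K12 _ _ K1b K2a; congr K; apply/rowP => i.
  by rewrite /e !mxE; field.
rewrite (indic_in K1a) (indic_in K2a) (indic_in K1b) (indic_in K2b) !mul1r.
rewrite /pair_weight /= (indic_in Kx) (indic_in Ky) !mul1r.
rewrite /gwt -!expRD -expRM_natl ler_expR.
rewrite -subr_ge0 [X in 0 <= X](_ : _ = 2^-1 * (
  A * (nrm2 (m + 2^-1 *: d1) + nrm2 (m - 2^-1 *: d2)) +
  B * (nrm2 (m - 2^-1 *: d1) + nrm2 (m + 2^-1 *: d2)) -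
  2 * (a * (nrm2 (m + 2^-1 *: e) + nrm2 (m - 2^-1 *: e)) -
     2 * c * dotp (m + 2^-1 *: e) (m - 2^-1 *: e)))); last by field.
apply: mulr_ge0; first by lra.
rewrite subr_ge0 /nrm2 /dotp -!big_split/= !mulr_sumr -sumrB mulr_sumr -big_split/=.
apply: ler_sum => i _; rewrite !mxE.
exact: (midpoint_quadratic _ _ _ A0 B0 P1E P2E aP cE).
Qed.

(** Since [expR z <= 1 / (1 - z)], the sum is at most [2 / (1 - z^2)], and [1 / (1 - w) <= 1 + 2 w]
    for [0 <= w <= 1/2]. No linear term survives. *)
Lemma cosh_le (z : R) : `|z| <= 2^-1 -> expR z + expR (- z) <= 2 * (1 + 2 * z ^+ 2).
Proof.
rewrite ler_norml => /andP[z1 z2].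
have h1 : expR z <= (1 - z)^-1.
  rewrite -[z in expR z]opprK expRN lef_pV2 ?posrE ?expR_gt0//; last by lra.
  exact: expR_ge1Dx.
have h2 : expR (- z) <= (1 + z)^-1.
  rewrite expRN lef_pV2 ?posrE ?expR_gt0//; last by lra.
  exact: expR_ge1Dx.
apply: (le_trans (lerD h1 h2)).
have zz : z ^+ 2 <= 2^-1 by rewrite expr2; nra.
have z20 := sqr_ge0 z.
have -> : (1 - z)^-1 + (1 + z)^-1 = 2 / (1 - z ^+ 2).
  by field; rewrite !gt_eqF//; lra.
rewrite ler_pdivrMr; last by lra.
by nra.
Qed.

(** A loss linear in [eta] would be too large: [eta] will be of order [t^2], and only its square is
    negligible against a second difference. The symmetrisation is done in [y] alone, for each fixed
    [x]. *)
Lemma gint_defect (A B P1 P2 a c eta : R) (K1 K2 K : set V) : 0 < A -> 0 < B ->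
  P1 = (A + B) / 4 -> P2 * (A + B) = A * B -> a <= P1 + P2 -> c = P1 - P2 ->
  measurable K1 -> measurable K2 -> measurable K ->
  (forall x y, K1 x -> K2 y -> K (2^-1 *: (x + y))) ->
  (forall x, K x -> K (- x)) ->
  (forall x y, K x -> K y -> `|c * dotp x y| <= eta) -> eta <= 2^-1 ->
  (gint A K1 * gint B K2 <= (1 + 2 * eta ^+ 2)%:E * (gint a K * gint a K))%E.
Proof.
move=> A0 B0 P1E P2E aP cE mK1 mK2 mK K12 Ks Keta eta2.
apply: (le_trans (gint_doubling A0 B0 P1E P2E aP cE mK1 mK2 mK K12)).
have KN (y : V) : \1_K (- y) = \1_K y :> R.
  rewrite !indicE; congr (_%:R); congr nat_of_bool; apply/idP/idP; rewrite !inE.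
    by move=> /Ks; rewrite opprK.
  exact: Ks.
have eta1 : 0 <= 1 + 2 * eta ^+ 2 by rewrite addr_ge0// mulr_ge0// sqr_ge0.
have mg := measurable_gint_fun a mK.
have g0 x : (0 <= (\1_K x * gwt a x)%:E)%E by rewrite lee_fin mulr_ge0 ?gwt_ge0.
have mW := measurable_pair_weight a c mK.
have W0 p : (0 <= (pair_weight a c K p)%:E)%E by rewrite lee_fin pair_weight_ge0.
have slice x : (\int[mu]_y (pair_weight a c K (x, y))%:E <=
    (\1_K x * gwt a x)%:E * ((1 + 2 * eta ^+ 2)%:E * gint a K))%E.
  have mWx : measurable_fun setT (fun y : V => (pair_weight a c K (x, y))%:E).
    exact: (measurable_section2 x mW).
  have mWxN : measurable_fun setT (fun y : V => (pair_weight a c K (x, - y))%:E).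
    have mN : measurable_fun setT (fun y : V => - y).
      rewrite (_ : (fun y : V => - y) = (fun y : V => -1 *: y)); last first.
        by apply/funext => y; rewrite scaleN1r.
      exact: measurable_rvZ.
    exact: (measurableT_comp mWx mN).
  have refl : (\int[mu]_y (pair_weight a c K (x, - y))%:E =
      \int[mu]_y (pair_weight a c K (x, y))%:E)%E.
    by apply: (ge0_integral_opp mWx) => y; exact: W0.
  have eta_lee : (\int[mu]_y (pair_weight a c K (x, y))%:E
      + \int[mu]_y (pair_weight a c K (x, - y))%:E <=
      (\1_K x * gwt a x)%:E * ((2 * (1 + 2 * eta ^+ 2))%:E * gint a K))%E.
    rewrite -(ge0_integralD mu measurableT (fun y _ => W0 (x, y)) mWx
      (fun y _ => W0 (x, - y)) mWxN).
    have e2 : (0%R <= (2 * (1 + 2 * eta ^+ 2))%:E)%E by rewrite lee_fin mulr_ge0.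
    rewrite /gint -(ge0_integralZl mu measurableT mg (fun y _ => g0 y) e2).
    have e3 (y : V) : [set: V] y -> (0%R <= (2 * (1 + 2 * eta ^+ 2))%:E * (\1_K y * gwt a y)%:E)%E.
      by move=> _; exact: mule_ge0.
    have mg' : measurable_fun setT (fun y : V => (2 * (1 + 2 * eta ^+ 2))%:E * (\1_K y * gwt a y)%:E)%E.
      exact: measurable_funeM.
    rewrite -(ge0_integralZl mu measurableT mg' e3 (g0 x)).
    apply: ge0_le_integral => //.
    - by move=> y _; apply: adde_ge0; exact: W0.
    - exact: emeasurable_funD.
    - by apply: measurable_funeM; apply: measurable_funeM; exact: mg.
    move=> y _; rewrite -!EFinM -EFinD lee_fin /pair_weight /= KN nrm2N dotpN.
    have [Kx|Kx] := pselect (K x); last by rewrite (indic_notin Kx) !mul0r addr0.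
    have [Ky|Ky] := pselect (K y); last by rewrite (indic_notin Ky) !(mulr0, mul0r) addr0.
    rewrite (indic_in Kx) (indic_in Ky) !mul1r !expRD mulrDr expRD mulrN.
    rewrite -/(gwt a x) -/(gwt a y) -mulrDr.
    rewrite [X in _ <= X](_ : _ = gwt a x * gwt a y * (2 * (1 + 2 * eta ^+ 2))); last by ring.
    apply: ler_wpM2l; first by rewrite mulr_ge0 ?gwt_ge0.
    have ce := Keta x y Kx Ky.
    apply: (le_trans (cosh_le (le_trans ce eta2))).
    rewrite ler_pM2l// lerD2l ler_pM2l// -[X in X <= _]real_normK ?num_real//.
    by rewrite ler_sqr ?nnegrE//; exact: le_trans ce.
  move: eta_lee; rewrite refl; set I := (\int[mu]_y _)%E => h.
  rewrite -(@lee_pmul2l _ 2%:E)// (_ : 2%:E * I = I + I)%E; last first.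
    by rewrite -[2]/(1 + 1) EFinD ge0_muleDl ?mul1e// integral_ge0.
  by apply: (le_trans h); rewrite [leRHS]muleCA [X in (_ <= _ * X)%E]muleA -EFinM.
apply: (@le_trans _ _ (\int[mu]_x ((\1_K x * gwt a x)%:E * ((1 + 2 * eta ^+ 2)%:E * gint a K)))%E).
  apply: ge0_le_integral => //.
  - by move=> x _; apply: integral_ge0 => y _; exact: W0.
  - by apply: (measurable_fun_fubini_tonelli_F _ mW) => p; exact: W0.
  - apply: (emeasurable_funM mg); exact: measurable_cst.
rewrite ge0_integralZr//; last by rewrite mule_ge0// gint_ge0.
by rewrite muleCA.
Qed.

End gaussian_weight.

Section gint_theory.
Context {R : realType}.
Local Notation mR := (measurableTypeR R).

Lemma integral_lebesgue_rV_prod n (f : 'I_n -> mR -> R) (c : 'I_n -> R) :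
  (forall i, measurable_fun setT (f i)) -> (forall i t, 0 <= f i t) ->
  (forall i, (\int[@lebesgue_measure R]_t (f i t)%:E)%E = (c i)%:E) ->
  (\int[lebesgue_rV R n]_x (\prod_i f i (x ord0 i))%:E = (\prod_i c i)%:E)%E.
Proof.
elim: n f c => [|n IH] f c mf f0 fc.
  rewrite integral_lebesgue_rV0 ?big_ord0//.
  rewrite (_ : (fun x => _) = cst 1%:E)//.
  by apply/funext => x; rewrite big_ord0.
have mF : measurable_fun setT
    (fun x : 'rV[R]_n.+1 => (\prod_i f i (x ord0 i))%:E).
  apply/measurable_EFinP; apply: measurable_prod => i _.
  exact: measurableT_comp (mf i) (measurable_rv_coor i).
rewrite integral_lebesgue_rVS//; last by move=> x; rewrite lee_fin prodr_ge0.
rewrite big_ord_recl EFinM.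
have E t : (\int[lebesgue_rV R n]_x (\prod_(i < n.+1) f i (vcons t x ord0 i))%:E =
    (f ord0 t)%:E * (\prod_(i < n) c (lift ord0 i))%:E)%E.
  rewrite -(IH (fun i => f (lift ord0 i)))//.
  have mG : measurable_fun setT
      (fun x : 'rV[R]_n => (\prod_i f (lift ord0 i) (x ord0 i))%:E).
    apply/measurable_EFinP; apply: measurable_prod => i _.
    exact: measurableT_comp (mf _) (measurable_rv_coor i).
  rewrite -(ge0_integralZl (lebesgue_rV R n) measurableT mG)//; last 2 first.
  - by move=> x _; rewrite lee_fin prodr_ge0.
  - by rewrite lee_fin.
  apply: eq_integral => x _; rewrite big_ord_recl vcons0 EFinM.
  by congr (_ * _%:E)%E; apply: eq_bigr => i _; rewrite vconsS.
under eq_integral do rewrite E.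
rewrite ge0_integralZr//; last 3 first.
- by apply/measurable_EFinP; exact: mf.
- by move=> t _; rewrite lee_fin.
- have c0 i : 0 <= c i.
    by rewrite -lee_fin -fc; apply: integral_ge0 => t _; rewrite lee_fin.
  by rewrite lee_fin prodr_ge0.
by rewrite fc.
Qed.

Context {n : nat}.
Local Notation V := 'rV[R]_n.
Local Notation mu := (lebesgue_rV R n).

Definition bounded_by (r : R) (K : set V) := forall x, K x -> forall i, `|x ord0 i| <= r.

Lemma nrm2_bounded (r : R) (x : V) : (forall i, `|x ord0 i| <= r) -> nrm2 x <= n%:R * r ^+ 2.
Proof.
move=> xr; rewrite /nrm2.
apply: (@le_trans _ _ (\sum_(i < n) r ^+ 2)).
  apply: ler_sum => i _; rewrite -real_normK ?num_real// ler_sqr ?nnegrE//.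
  exact: le_trans (xr i).
by rewrite sumr_const card_ord mulr_natl.
Qed.

Lemma dotp_bounded (r : R) (x y : V) : (forall i, `|x ord0 i| <= r) ->
  (forall i, `|y ord0 i| <= r) -> `|dotp x y| <= n%:R * r ^+ 2.
Proof.
move=> xr yr; rewrite /dotp; apply: (le_trans (ler_norm_sum _ _ _)).
apply: (@le_trans _ _ (\sum_(i < n) r ^+ 2)).
  by apply: ler_sum => i _; rewrite normrM expr2 ler_pM.
by rewrite sumr_const card_ord mulr_natl.
Qed.

Lemma le_gint (q : R) (K K' : set V) : measurable K -> measurable K' ->
  K `<=` K' -> (gint q K <= gint q K')%E.
Proof.
move=> mK mK' KK'; apply: ge0_le_integral => //.
- by move=> x _; rewrite lee_fin mulr_ge0 ?gwt_ge0.
- exact: measurable_gint_fun.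
- exact: measurable_gint_fun.
- move=> x _; rewrite lee_fin; apply: ler_wpM2r; first exact: gwt_ge0.
  have [Kx|Kx] := pselect (K x); last by rewrite (indic_notin Kx).
  by rewrite (indic_in Kx) (indic_in (KK' _ Kx)).
Qed.

Lemma gint_fin (q r : R) (K : set V) : 0 <= q -> measurable K ->
  bounded_by r K -> gint q K \is a fin_num.
Proof.
move=> q0 mK Kr.
have r0 : 0 <= `|r| by [].
have H := @integral_lebesgue_rV_prod n (fun _ => \1_([set` `[- r, r]%R] : set mR))
   (fun _ => fine (@lebesgue_measure R [set` `[- r, r]%R])).
have : (gint q K <= \int[mu]_x (\prod_(i < n) \1_([set` `[- r, r]%R] : set mR) (x ord0 i))%:E)%E.
  apply: ge0_le_integral => //.
  - by move=> x _; rewrite lee_fin mulr_ge0 ?gwt_ge0.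
  - exact: measurable_gint_fun.
  - apply/measurable_EFinP; apply: measurable_prod => i _.
    by apply: (measurableT_comp _ (measurable_rv_coor i)); exact: measurable_indic.
  - move=> x _; rewrite lee_fin.
    have [Kx|Kx] := pselect (K x); last first.
      by rewrite (indic_notin Kx) mul0r prodr_ge0.
    rewrite (indic_in Kx) mul1r big1; last first.
      by move=> i _; rewrite indicE mem_set//= in_itv/= -ler_norml; exact: Kr.
    rewrite /gwt -expR0 ler_expR mulNr oppr_le0 mulr_ge0 ?nrm2_ge0//.
    by rewrite divr_ge0.
rewrite H//.
- by move=> le; rewrite ge0_fin_numE ?gint_ge0//; exact: le_lt_trans le (ltry _).
- move=> i; rewrite integral_indic//= setIT fineK//.
  by rewrite lebesgue_measure_itv; case: ifP.
Qed.

(** On a bounded set all the weights are comparable, so positivity of the integral passes from one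
    weight to another. *)
Lemma gint_compare (q q' r : R) (K : set V) : 0 <= q -> 0 <= q' -> measurable K ->
  bounded_by r K ->
  ((expR (- (q / 2) * (n%:R * r ^+ 2)))%:E * gint q' K <= gint q K)%E.
Proof.
move=> q0 q'0 mK Kr.
have e0 : (0%R <= (expR (- (q / 2) * (n%:R * r ^+ 2)))%:E)%E by rewrite lee_fin expR_ge0.
have g0 (x : V) : [set: V] x -> (0%R <= (\1_K x * gwt q' x)%:E)%E.
  by rewrite lee_fin mulr_ge0 ?gwt_ge0.
rewrite /gint -(ge0_integralZl mu measurableT (measurable_gint_fun q' mK) g0 e0).
apply: ge0_le_integral => //.
- by move=> x _; rewrite mule_ge0// g0.
- by apply: measurable_funeM; exact: measurable_gint_fun.
- exact: measurable_gint_fun.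
move=> x _; rewrite -EFinM lee_fin.
have [Kx|Kx] := pselect (K x); last by rewrite (indic_notin Kx) !mul0r mulr0.
rewrite (indic_in Kx) !mul1r -[leRHS]mulr1; apply: ler_pM; rewrite ?expR_ge0//.
  by rewrite ler_expR !mulNr lerN2 ler_wpM2l ?divr_ge0//; apply: nrm2_bounded; exact: Kr.
rewrite /gwt -expR0 ler_expR mulNr oppr_le0 mulr_ge0 ?nrm2_ge0//.
by rewrite divr_ge0.
Qed.

Lemma gint_scale (q c : R) (K K' : set V) : 0 < c -> measurable K' ->
  (forall x, K x <-> K' (c *: x)) ->
  (gint q K' = (c ^+ n)%:E * gint (q * c ^+ 2) K)%E.
Proof.
move=> c0 mK' KK'.
have mf := measurable_gint_fun q mK'.
have f0 (x : V) : (0%R <= (\1_K' x * gwt q x)%:E)%E by rewrite lee_fin mulr_ge0 ?gwt_ge0.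
have := @ge0_integral_affine R n c 0%R _ (negbT (gt_eqF c0)) mf f0.
have -> : (\int[mu]_x (\1_K' (c *: x + 0) * gwt q (c *: x + 0))%:E)%E = gint (q * c ^+ 2) K.
  apply: eq_integral => x _; rewrite addr0 /gwt nrm2Z; congr (_ * expR _)%:E.
    rewrite !indicE; congr (_%:R); congr nat_of_bool.
    by apply/idP/idP; rewrite !inE => /KK'.
  by field.
rewrite gtr0_norm// -/(gint q K') => ->.
by rewrite muleA -EFinM -exprMn divff ?gt_eqF// expr1n mul1e.
Qed.

Lemma measurable_scale (c : R) (K K' : set V) : 0 < c -> measurable K ->
  (forall x, K x <-> K' (c *: x)) -> measurable K'.
Proof.
move=> c0 mK KK'.
have mZ : measurable_fun setT (fun x : V => c^-1 *: x) by exact: measurable_rvZ.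
have := mZ measurableT _ mK; rewrite setTI; congr measurable.
apply/seteqP; split => x /=.
  by move=> /KK'; rewrite scalerA divff ?gt_eqF// scale1r.
by move=> K'x; apply/KK'; rewrite scalerA divff ?gt_eqF// scale1r.
Qed.

End gint_theory.

(** * Open sets, grids of cells and Minkowski combinations *)

Section open_sets.
Context {R : realType} {n : nat}.
Local Notation V := 'rV[R]_n.
Implicit Types (U K : set V).

Definition near_pt (d : R) (x y : V) := forall i, `|y ord0 i - x ord0 i| < d.

(** Openness for the sup distance, written in coordinates to match a sigma-algebra that is generated
    by the coordinates rather than by a topology. *)
Definition cube_open U := forall x, U x -> exists2 d, 0 < d & forall y, near_pt d x y -> U y.

Lemma measurable_box (a b : V) : measurable (box a b).
Proof.
have -> : box a b = \bigcap_(i in [set: 'I_n])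
    (rv_coor i @^-1` ([set` `]a ord0 i, b ord0 i]%R] : set (measurableTypeR R))).
  apply/seteqP; split => x /= h.
    by move=> i _; rewrite /= in_itv/=; exact: h.
  by move=> i; have := h i I; rewrite /= in_itv.
apply: fin_bigcap_measurable => // i _.
rewrite -[X in measurable X]setTI; apply: measurable_rv_coor => //.
Qed.

Definition cell_lo (h : R) (z : 'rV[int]_n) : V := \row_i (h * (z ord0 i)%:~R).
Definition cell_hi (h : R) (z : 'rV[int]_n) : V := \row_i (h * (z ord0 i + 1)%:~R).
Definition cell h z := box (cell_lo h z) (cell_hi h z).

Lemma cell_cover (h : R) (x : V) : 0 < h -> exists z, cell h z x.
Proof.
(* Cells are open on the left and closed on the right, hence the ceiling minus one rather than the
   floor. *)
move=> h0; exists (\row_i (Num.ceil (x ord0 i / h) - 1)) => i; rewrite !mxE.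
rewrite mulrC -ltr_pdivlMr// [h * _]mulrC -ler_pdivrMr//.
by rewrite subrK ceil_ge andbT ceilB1_lt.
Qed.

Lemma cell_inj (h : R) z z' x : 0 < h -> cell h z x -> cell h z' x -> z = z'.
Proof.
move=> h0 zx z'x; apply/rowP => i.
have := zx i; have := z'x i; rewrite !mxE => /andP[a1 a2] /andP[b1 b2].
have := lt_le_trans a1 b2; have := lt_le_trans b1 a2.
by rewrite !ltr_pM2l// !ltr_int !ltzD1 => p1 p2; apply/eqP; rewrite eq_le p1 p2.
Qed.

Lemma cell_near (h : R) z x y : cell h z x -> cell h z y -> 0 < h -> near_pt h x y.
Proof.
move=> zx zy h0 i; have := zx i; have := zy i; rewrite !mxE.
rewrite !intrD !mulrDr mulr1 => /andP[a1 a2] /andP[b1 b2].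
by rewrite ltr_norml; apply/andP; split; lra.
Qed.

Definition celln (h : R) (k : nat) : set V :=
  if pickle_inv k is Some z then cell h z else set0.

Lemma measurable_celln h k : measurable (celln h k).
Proof. by rewrite /celln; case: pickle_inv => // z; exact: measurable_box. Qed.

Lemma celln_cover (h : R) (x : V) : 0 < h -> exists k, celln h k x.
Proof.
by move=> h0; have [z zx] := cell_cover x h0; exists (pickle z); rewrite /celln pickleK_inv.
Qed.

Lemma celln_near (h : R) k x y : celln h k x -> celln h k y -> 0 < h -> near_pt h x y.
Proof. by rewrite /celln; case: pickle_inv => // z; exact: cell_near. Qed.

Lemma trivIset_celln (h : R) : 0 < h -> trivIset setT (celln h).
Proof.
move=> h0; apply/trivIsetP => k l _ _ kl; rewrite -subset0 => x [].
rewrite /celln; case Ek: pickle_inv => [z|//]; case El: pickle_inv => [z'|//] zx z'x.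
move: kl; have zz := cell_inj h0 zx z'x.
have := @pickle_invK 'rV[int]_n l; have := @pickle_invK 'rV[int]_n k.
by rewrite Ek El /= zz => <- <-; rewrite eqxx.
Qed.

(** An open set is the union, over the meshes [1 / (m + 1)], of the cells it contains, and these are
    countably many. *)
Lemma measurable_cube_open U : cube_open U -> measurable U.
Proof.
move=> oU.
pose W m k : set V := if `[< celln (m.+1%:R^-1) k `<=` U >] then celln (m.+1%:R^-1) k else set0.
have -> : U = \bigcup_m \bigcup_k W m k.
  apply/seteqP; split => x.
    move=> Ux; have [d d0 dU] := oU _ Ux.
    have [m md] : exists m, m.+1%:R^-1 < d.
      by exists (Num.trunc d^-1); rewrite invf_plt ?posrE//; exact: truncnS_gt.
    have m0 : 0 < m.+1%:R^-1 :> R by rewrite invr_gt0.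
    have [k kx] := celln_cover x m0.
    exists m => //; exists k => //; rewrite /W; case: asboolP => // ns.
    case: ns => y ky; apply: dU => i; apply: lt_trans md.
    exact: (celln_near kx ky m0).
  by move=> [m _ [k _]]; rewrite /W; case: asboolP => // + kx; apply.
apply: bigcupT_measurable => m; apply: bigcupT_measurable => k.
by rewrite /W; case: asboolP => // _; exact: measurable_celln.
Qed.

(** Independent coefficients make the definition symmetric in the two sets and include dilates, as
    [mink_sum t 0 K L]. *)
Definition mink_sum (s t : R) (K L : set V) : set V :=
  [set x | exists a b, [/\ K a, L b & x = s *: a + t *: b]].

Lemma mink_sumC s t K L : mink_sum s t K L = mink_sum t s L K.
Proof.
by apply/seteqP; split => x [a [b [Ka Lb ->]]]; exists b, a; rewrite addrC.
Qed.

Lemma cube_open_mink_suml s t K L : 0 < s -> cube_open K -> cube_open (mink_sum s t K L).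
Proof.
move=> s0 oK x [a [b [Ka Lb xE]]]; have [d d0 dK] := oK _ Ka.
exists (s * d); first by rewrite mulr_gt0.
move=> y xy; exists (a + s^-1 *: (y - x)), b; split=> //.
  apply: dK => i; rewrite !mxE addrAC subrr add0r normrM gtr0_norm ?invr_gt0//.
  by rewrite mulrC ltr_pdivrMr// mulrC; exact: xy.
rewrite scalerDr scalerA divff ?gt_eqF// scale1r addrAC -xE.
by rewrite addrC subrK.
Qed.

Lemma cube_open_mink_sum s t K L : 0 <= s -> 0 <= t -> 0 < s + t -> cube_open K -> cube_open L ->
  cube_open (mink_sum s t K L).
Proof.
move=> s0 t0 st oK oL; have [sp|s_le0] := ltP 0 s; first exact: cube_open_mink_suml.
by rewrite mink_sumC; apply: cube_open_mink_suml => //; lra.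
Qed.

Definition cvx K := forall x y, K x -> K y -> forall t, 0 <= t <= 1 ->
  K (t *: x + (1 - t) *: y).

Definition symm K := forall x, K x -> K (- x).

(** Homogeneous form of convexity, free of normalisation; if [s + t = 0] both coefficients vanish
    and [x] itself serves. *)
Lemma cvx_comb K x y s t : cvx K -> K x -> K y -> 0 <= s -> 0 <= t ->
  exists2 z, K z & s *: x + t *: y = (s + t) *: z.
Proof.
move=> cK Kx Ky s0 t0; have [st|st] := ltP 0 (s + t); last first.
  have -> : s = 0 by lra.
  have -> : t = 0 by lra.
  by exists x => //; rewrite addr0 !scale0r addr0.
exists ((s / (s + t)) *: x + (1 - s / (s + t)) *: y).
  by apply: cK => //; rewrite divr_ge0 ?(ltW st)//= ler_pdivrMr// mul1r lerDl.
rewrite scalerDr !scalerA; congr (_ *: _ + _ *: _); field; exact: lt0r_neq0.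
Qed.

Lemma mink_sum_mid s t s' t' K L x y : cvx K -> cvx L ->
  0 <= s -> 0 <= t -> 0 <= s' -> 0 <= t' ->
  mink_sum s t K L x -> mink_sum s' t' K L y ->
  mink_sum (2^-1 * (s + s')) (2^-1 * (t + t')) K L (2^-1 *: (x + y)).
Proof.
move=> cK cL s0 t0 s'0 t'0 [a [b [Ka Lb ->]]] [a' [b' [Ka' Lb' ->]]].
have [u Ku uE] := cvx_comb cK Ka Ka' s0 s'0.
have [v Lv vE] := cvx_comb cL Lb Lb' t0 t'0.
exists u, v; split=> //.
by rewrite addrACA uE vE scalerDr !scalerA.
Qed.

Lemma cvx_mink_sum s t K L : cvx K -> cvx L -> cvx (mink_sum s t K L).
Proof.
move=> cK cL _ _ [a [b [Ka Lb ->]]] [a' [b' [Ka' Lb' ->]]] u u01.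
exists (u *: a + (1 - u) *: a'), (u *: b + (1 - u) *: b'); split.
- exact: cK.
- exact: cL.
by rewrite !scalerDr !scalerA addrACA ![u * _]mulrC ![(1 - u) * _]mulrC.
Qed.

Lemma symm_mink_sum s t K L : symm K -> symm L -> symm (mink_sum s t K L).
Proof.
move=> sK sL _ [a [b [Ka Lb ->]]]; exists (- a), (- b); split; [exact: sK|exact: sL|].
by rewrite opprD !scalerN.
Qed.

Lemma bounded_mink_sum s t r K L : 0 <= s -> 0 <= t -> bounded_by r K -> bounded_by r L ->
  bounded_by ((s + t) * r) (mink_sum s t K L).
Proof.
move=> s0 t0 bK bL _ [a [b [Ka Lb ->]]] i; rewrite !mxE.
apply: (le_trans (ler_normD _ _)); rewrite !normrM (ger0_norm s0) (ger0_norm t0) mulrDl.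
by apply: lerD; apply: ler_wpM2l => //; [exact: bK|exact: bL].
Qed.

Lemma cvx_symm0 K : K !=set0 -> cvx K -> symm K -> K 0.
Proof.
move=> [x Kx] cK sK; have := cK _ _ Kx (sK _ Kx) 2^-1.
rewrite (_ : 2^-1 *: x + _ = 0); last first.
  by apply/rowP => i; rewrite !mxE; field.
by apply; lra.
Qed.

End open_sets.

(** * Discrete minimum principle and weight estimates *)

Section real_lemmas.
Context {R : realType}.

(** Suppose the minimum lies below [m]. At the first index where it is attained, necessarily
    interior, the left neighbour is strictly larger and the right one no smaller, which contradicts
    the hypothesis there. *)
Lemma min_principle (N : nat) (b : nat -> R) (m : R) :
  (forall k, (k <= N)%N -> 0 < b k) ->
  (forall k, (0 < k < N)%N -> b k.+1 * b k.-1 <= b k ^+ 2) ->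
  m <= b 0%N -> m <= b N -> forall k, (k <= N)%N -> m <= b k.
Proof.
move=> b0 bb m0 mN k kN; rewrite leNgt; apply/negP => bkm.
pose P i := (i <= N)%N && [forall j : 'I_N.+1, b i <= b j].
have exP : exists i, P i.
  have [i _ ilt] := @arg_minP _ _ _ (ord0 : 'I_N.+1) xpredT (fun i : 'I_N.+1 => b i) isT.
  by exists i; apply/andP; split; [rewrite -ltnS ltn_ord|apply/forallP => j; exact: ilt].
case: (ex_minnP exP) => i /andP[iN /forallP imin] ismall.
have iminP j : (j <= N)%N -> b i <= b j by move=> jN; exact: (imin (Ordinal (jN : (j < N.+1)%N))).
have bim : b i < m by exact: le_lt_trans (iminP k kN) bkm.
have i0 : (0 < i)%N by rewrite lt0n; apply/negP => /eqP i0; move: bim; rewrite i0 ltNge m0.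
have iN' : (i < N)%N by rewrite ltn_neqAle iN andbT; apply/negP => /eqP i0'; move: bim; rewrite i0' ltNge mN.
have := bb i; rewrite i0 iN' => /(_ isT); apply/negP; rewrite -ltNge expr2.
have p1 : b i < b i.-1.
  rewrite lt_neqAle iminP ?andbT; last by lia.
  apply/negP => /eqP bE; have := ismall i.-1.
  rewrite /P; have -> : (i.-1 <= N)%N by lia.
  have -> : [forall j : 'I_N.+1, b i.-1 <= b j] by apply/forallP => j; rewrite -bE; exact: imin.
  by move=> /(_ isT); lia.
have bi := b0 _ iN.
rewrite [ltRHS]mulrC; apply: (@le_lt_trans _ _ (b i * b i.+1)).
  by rewrite ler_pM2l//; apply: iminP.
by rewrite ltr_pM2r//; apply: b0.
Qed.

(** As [P1 * P2 = A * B / 4], the arithmetic-geometric mean inequality gives [P1 + P2 >= 1 / (P M)],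
    and a second use gives [P M <= ((P + M) / 2)^2]. The difference [P1 - P2] carries the factor
    [(P - M)^2], hence is of second order in the step. *)
Lemma inverse_square_weights (l P M : R) : 0 < l -> l <= P -> l <= M ->
  let A := P ^- 2 in let B := M ^- 2 in
  let P1 := (A + B) / 4 in let P2 := A * B / (A + B) in
  [/\ ((P + M) / 2) ^- 2 <= P1 + P2, 0 <= P1 - P2 &
      P1 - P2 <= (P - M) ^+ 2 / (2 * l ^+ 4)].
Proof.
move=> l0 lP lM A B P1 P2.
have P0 : 0 < P by lra. have M0 : 0 < M by lra.
have S0 : 0 < P ^+ 2 + M ^+ 2 by rewrite addr_gt0// exprn_gt0.
have Q0 : 0 < P * M by rewrite mulr_gt0.
have nz : [/\ P != 0, M != 0, P ^+ 2 + M ^+ 2 != 0 & P + M != 0].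
  by split; rewrite gt_eqF// addr_gt0.
have [nP nM nS nPM] := nz.
have nS' : M ^+ 2 + P ^+ 2 != 0 by rewrite addrC.
have P1E : P1 = (P ^+ 2 + M ^+ 2) / (4 * (P * M) ^+ 2).
  by rewrite /P1 /A /B; field; rewrite ?nP ?nM.
have P2E : P2 = (P ^+ 2 + M ^+ 2)^-1.
  by rewrite /P2 /A /B; field; rewrite ?nP ?nM ?nS ?nS'.
have cE : P1 - P2 = (P ^+ 2 - M ^+ 2) ^+ 2 / (4 * (P * M) ^+ 2 * (P ^+ 2 + M ^+ 2)).
  by rewrite P1E P2E; field; rewrite ?nP ?nM ?nS ?nS'.
have D0 : 0 < 4 * (P * M) ^+ 2 * (P ^+ 2 + M ^+ 2).
  by rewrite mulr_gt0// mulr_gt0// exprn_gt0.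
split.
- apply: (@le_trans _ _ (P * M)^-1).
    rewrite lef_pV2 ?posrE ?exprn_gt0 ?divr_gt0 ?addr_gt0//.
    by have := sqr_ge0 (P - M); rewrite expr_div_n sqrrB sqrrD; lra.
  rewrite -subr_ge0 (_ : _ - _ = (P - M) ^+ 4 / (4 * (P * M) ^+ 2 * (P ^+ 2 + M ^+ 2))).
    by rewrite divr_ge0 ?(ltW D0)// (exprM _ 2 2) sqr_ge0.
  by rewrite P1E P2E; field; rewrite ?nP ?nM ?nS ?nS'.
- by rewrite cE divr_ge0 ?(ltW D0) ?sqr_ge0.
rewrite cE ler_pdivrMr// mulrAC ler_pdivlMr; last by rewrite mulr_gt0 ?exprn_gt0.
have h1 : (P ^+ 2 - M ^+ 2) ^+ 2 <= (P - M) ^+ 2 * (2 * (P ^+ 2 + M ^+ 2)).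
  rewrite subr_sqr exprMn; apply: ler_wpM2l; first exact: sqr_ge0.
  by have := sqr_ge0 (P - M); rewrite sqrrB sqrrD; lra.
have h2 : l ^+ 4 <= (P * M) ^+ 2.
  have l0' := ltW l0.
  have -> : l ^+ 4 = (l * l) ^+ 2 by ring.
  rewrite ler_sqr ?nnegrE; [|exact: mulr_ge0|exact: ltW].
  by apply: ler_pM.
apply: (@le_trans _ _ ((P - M) ^+ 2 * (2 * (P ^+ 2 + M ^+ 2)) * (2 * (P * M) ^+ 2))).
  apply: ler_pM => //; first exact: sqr_ge0.
    by rewrite mulr_ge0 ?exprn_ge0 ?ltW.
  by rewrite ler_pM2l.
by rewrite le_eqVlt; apply/orP; left; apply/eqP; ring.
Qed.

Lemma le_of_small_factor (m f D : R) : 0 < m ->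
  (\forall j \near \oo, m <= f * expR (D / j.+1%:R)) -> m <= f.
Proof.
move=> m0 [J _ H]; rewrite leNgt; apply/negP => fm.
(* Beyond this index [m * (1 - D / j.+1)] exceeds [f]. *)
pose j := maxn J (Num.trunc (m * D / (m - f))).
have := H j; rewrite /= leq_maxl => /(_ isT); apply/negP; rewrite -ltNge.
have mf : 0 < m - f by rewrite subr_gt0.
have jD : m * D / (m - f) < j.+1%:R.
  by apply: lt_le_trans (truncnS_gt _) _; rewrite ler_nat ltnS leq_maxr.
have j0 : 0 < j.+1%:R :> R by [].
have e0 := expR_gt0 (D / j.+1%:R).
rewrite -ltr_pdivlMr// -expRN; apply: (@lt_le_trans _ _ (m * (1 - D / j.+1%:R))).
  rewrite mulrBr mulr1 ltrBrDl -ltrBrDr mulrA ltr_pdivrMr//.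
  by move: jD; rewrite ltr_pdivrMr// [j.+1%:R * _]mulrC.
by rewrite ler_pM2l//; exact: expR_ge1Dx.
Qed.

(** On the grid of step [h = 1 / M] with [M = N * j.+1], which still contains [k / N], a corrected
    sequence is exactly log-concave. The correction is 1 at both ends and at most [expR (C^2 / M^2)]
    in between, so it disappears as [j] grows. *)
Lemma le_rational_of_defect (f : R -> R) (C m : R) (N k : nat) :
  0 <= C -> 0 < m -> (0 < N)%N -> (k <= N)%N ->
  (forall s, 0 <= s <= 1 -> 0 < f s) ->
  (forall s t, 0 <= s - t -> 0 <= t -> s + t <= 1 -> C * t ^+ 2 <= 2^-1 ->
     f (s + t) * f (s - t) <= (1 + 2 * (C * t ^+ 2) ^+ 2) * f s ^+ 2) ->
  m <= f 0 -> m <= f 1 -> m <= f (k%:R / N%:R).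
Proof.
move=> C_ge0 m0 N0 kN f0 fdef m_0 m_1.
have ratio01 i M : (0 < M)%N -> (i <= M)%N -> 0 <= (i%:R / M%:R : R) <= 1.
  move=> M0 iM; rewrite divr_ge0//= ler_pdivrMr ?ltr0n// mul1r ler_nat//.
apply: (le_of_small_factor (D := C ^+ 2) m0).
have [J HJ] : exists J, forall j, (J <= j)%N -> C / (N * j.+1)%N%:R ^+ 2 <= 2^-1.
  exists (Num.trunc (2 * C)) => j Jj.
  have j1 : 2 * C < j.+1%:R by apply: lt_le_trans (truncnS_gt _) _; rewrite ler_nat.
  rewrite ler_pdivrMr ?exprn_gt0 ?ltr0n ?muln_gt0 ?N0//.
  have : j.+1%:R <= (N * j.+1)%N%:R ^+ 2 :> R.
    rewrite -natrX ler_nat; nia.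
  lra.
exists J => // j /= Jj; have Cj := HJ j Jj.
set M := (N * j.+1)%N in Cj; have M0 : (0 < M)%N by rewrite muln_gt0 N0.
pose h : R := M%:R^-1; have h0 : 0 < h by rewrite invr_gt0 ltr0n.
have Mn0 : M%:R != 0 :> R by rewrite pnatr_eq0 -lt0n.
pose e : R := (C * h ^+ 2) ^+ 2.
(* The second difference of [i * (M - i)] is [-2], so the exponential gains exactly the factor
   [expR (- 2 e)] that absorbs the defect [1 + 2 e <= expR (2 e)]. *)
pose b i := f (i%:R / M%:R) * expR (e * (i%:R * (M%:R - i%:R))).
have bm : m <= b (k * j.+1)%N.
  apply: (@min_principle M).
  - by move=> i iM; rewrite mulr_gt0 ?expR_gt0// f0// ratio01.
  - move=> i /andP[i0 iM].
    have i1 : i.+1%:R / M%:R = i%:R / M%:R + h :> R by rewrite -natr1 mulrDl mul1r.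
    have i2 : i.-1%:R / M%:R = i%:R / M%:R - h :> R.
      by rewrite -{2}(prednK i0) -natr1 mulrDl mul1r addrK.
    have /andP[_ r1] := ratio01 _ _ M0 (iM : (i.+1 <= M)%N).
    have /andP[r2 _] := ratio01 _ _ M0 (leq_trans (leq_pred i) (ltnW iM)).
    have xyz : f (i.+1%:R / M%:R) * f (i.-1%:R / M%:R) <=
        expR (2 * e) * f (i%:R / M%:R) ^+ 2.
      apply: (@le_trans _ _ ((1 + 2 * e) * f (i%:R / M%:R) ^+ 2)); last first.
        by apply: ler_wpM2r (expR_ge1Dx _); exact: sqr_ge0.
      rewrite i1 in r1 *; rewrite i2 in r2 *; apply: fdef => //; first exact: ltW.
      by rewrite /h exprVn.
    rewrite /b mulrACA -expRD exprMn -expRM_natl.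
    rewrite [X in expR X](_ : _ = 2%:R * (e * (i%:R * (M%:R - i%:R))) - 2 * e); last first.
      have -> : i.-1%:R = i%:R - 1 :> R by rewrite -{2}(prednK i0) -natr1 addrK.
      by rewrite -natr1; ring.
    apply: (le_trans (ler_wpM2r (expR_ge0 _) xyz)).
    by rewrite mulrAC -expRD mulrC addrC subrK.
  - by rewrite /b !mul0r mulr0 expR0 mulr1.
  - by rewrite /b divff// subrr !mulr0 expR0 mulr1.
  - by rewrite leq_pmul2r.
apply: (le_trans bm); rewrite /b.
have -> : (k * j.+1)%N%:R / M%:R = k%:R / N%:R :> R.
  rewrite /M !natrM -mulf_div divff ?mulr1//.
apply: ler_wpM2l; first by apply/ltW/f0/ratio01.
rewrite ler_expR.
apply: (@le_trans _ _ (e * M%:R ^+ 2)).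
  apply: ler_wpM2l; first exact: sqr_ge0.
  have kM : (k * j.+1)%N%:R <= M%:R :> R by rewrite ler_nat leq_pmul2r.
  rewrite expr2; apply: ler_pM => //; first by rewrite subr_ge0.
  by rewrite lerBlDr lerDl.
have -> : e * M%:R ^+ 2 = C ^+ 2 / M%:R ^+ 2.
  by rewrite /e /h; field.
apply: ler_wpM2l; first exact: sqr_ge0.
rewrite lef_pV2 ?posrE ?exprn_gt0 ?ltr0n//.
by rewrite -natrX ler_nat /M; nia.
Qed.


End real_lemmas.

(** * Approximate log-concavity along the interpolation *)

Section interpolation.
Context {R : realType} {n : nat}.
Local Notation V := 'rV[R]_n.
Variables (U W : set V) (r p0 p1 : R).
Hypotheses (oU : cube_open U) (oW : cube_open W) (cU : cvx U) (cW : cvx W)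
  (sU : symm U) (sW : symm W) (bU : bounded_by r U) (bW : bounded_by r W)
  (U0 : U 0) (W0 : W 0) (p00 : 0 < p0) (p10 : 0 < p1).

Let p (s : R) : R := (1 - s) * p0 + s * p1.
Let Kt s := mink_sum (1 - s) s U W.
(** The function [F] of the overview; the affine quantity is the standard deviation [p s], and the
    weight takes its inverse square. *)
Definition interp s := gint (p s ^- 2) (Kt s).

Let p_ge (s : R) : 0 <= s <= 1 -> Num.min p0 p1 <= p s.
Proof.
move=> /andP[s0 s1]; rewrite /p.
have h0 : Num.min p0 p1 <= p0 by rewrite ge_min lexx.
have h1 : Num.min p0 p1 <= p1 by rewrite ge_min lexx orbT.
have := ler_wpM2l s0 h1; have := ler_wpM2l (_ : 0 <= 1 - s) h0; lra.
Qed.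

Let l0 : 0 < Num.min p0 p1. Proof. by rewrite lt_min p00. Qed.

Let p_gt0 (s : R) : 0 <= s <= 1 -> 0 < p s.
Proof. by move=> s01; apply: lt_le_trans l0 (p_ge s01). Qed.

Let mKt (s : R) : 0 <= s <= 1 -> measurable (Kt s).
Proof. by move=> /andP[s0 s1]; apply: measurable_cube_open; apply: cube_open_mink_sum => //; lra. Qed.

Let bKt (s : R) : 0 <= s <= 1 -> bounded_by r (Kt s).
Proof.
move=> /andP[s0 s1]; have -> : r = ((1 - s) + s) * r by rewrite subrK mul1r.
by apply: bounded_mink_sum => //; lra.
Qed.

Let finK (s : R) : 0 <= s <= 1 -> interp s \is a fin_num.
Proof.
move=> s01; apply: (gint_fin _ (mKt s01) (bKt s01)).
by rewrite invr_ge0 exprn_ge0// ltW// p_gt0.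
Qed.

(** Since [0] belongs to [W], [Kt s] contains the dilate of [Kt 0] by [1 - s], which is
    non-degenerate for [s < 1]. Its integral is a positive multiple of one over [Kt 0] with another
    weight. *)
Let posK (s : R) : 0 <= s < 1 -> (0 < interp 0)%E -> (0 < interp s)%E.
Proof.
move=> /andP[s0 s1] F0.
have s01 : 0 <= s <= 1 by rewrite s0 ltW.
have s1' : 0 < 1 - s by lra.
have z01 : 0 <= (0 : R) <= 1 by rewrite lexx ler01.
have mU : measurable (Kt 0) by exact: mKt.
pose U' : set V := [set x | Kt 0 ((1 - s)^-1 *: x)].
have UU' x : Kt 0 x <-> U' ((1 - s) *: x).
  by rewrite /U' /= scalerA mulVf ?gt_eqF// scale1r.
have mU' : measurable U' by exact: (measurable_scale s1' mU UU').
have sub : U' `<=` Kt s.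
  move=> x [a [b [Ua Wb xE]]]; exists a, 0; split=> //.
  move: xE; rewrite subr0 scale1r scale0r addr0 scaler0 addr0 => <-.
  by rewrite scalerA divff ?gt_eqF// scale1r.
apply: lt_le_trans (le_gint _ mU' (mKt s01) sub).
rewrite (gint_scale _ s1' mU' UU').
have q0 : 0 <= p s ^- 2 * (1 - s) ^+ 2.
  by rewrite mulr_ge0 ?sqr_ge0// invr_ge0 sqr_ge0.
have q0' : 0 <= p 0 ^- 2 by rewrite invr_ge0 sqr_ge0.
apply: mule_gt0; first by rewrite lte_fin exprn_gt0.
apply: lt_le_trans (gint_compare q0 q0' mU (bKt z01)).
by rewrite mule_gt0 ?lte_fin ?expR_gt0.
Qed.

(** Obtained from the bound on [P1 - P2] with [p (s + t) - p (s - t) = 2 t (p1 - p0)], times the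
    bound [n r^2] for the scalar product on a cube; the factor [t^2] is split off. *)
Let C := 2 * (p1 - p0) ^+ 2 / Num.min p0 p1 ^+ 4 * (n%:R * r ^+ 2).

Let C_ge0 : 0 <= C.
Proof.
apply: mulr_ge0; last by rewrite mulr_ge0// sqr_ge0.
by apply: divr_ge0; [rewrite mulr_ge0// sqr_ge0|rewrite exprn_ge0// ltW].
Qed.

Lemma interp_defect (s t : R) : 0 <= s - t -> 0 <= t -> s + t <= 1 -> C * t ^+ 2 <= 2^-1 ->
  (interp (s + t) * interp (s - t) <=
   (1 + 2 * (C * t ^+ 2) ^+ 2)%:E * (interp s * interp s))%E.
Proof.
move=> st0 t0 st1 Ct.
have i1 : 0 <= s + t <= 1 by apply/andP; split; lra.
have i2 : 0 <= s - t <= 1 by apply/andP; split; lra.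
have i3 : 0 <= s <= 1 by apply/andP; split; lra.
have [h1 h2 h3] := inverse_square_weights l0 (p_ge i1) (p_ge i2).
have AB0 s' : 0 <= s' <= 1 -> 0 < p s' ^- 2 by move=> ?; rewrite invr_gt0 exprn_gt0// p_gt0.
have pE : (p (s + t) + p (s - t)) / 2 = p s by rewrite /p; field.
rewrite pE in h1.
apply: (gint_defect (AB0 _ i1) (AB0 _ i2) erefl _ h1 erefl) => //.
- by rewrite divfK// gt_eqF// addr_gt0// AB0.
- exact: mKt.
- exact: mKt.
- exact: mKt.
- move=> x y Kx Ky; have := mink_sum_mid cU cW _ _ _ _ Kx Ky.
  rewrite /Kt (_ : 2^-1 * _ = 1 - s); last by field.
  rewrite (_ : 2^-1 * _ = s); last by field.
  by apply; lra.
- exact: symm_mink_sum.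
move=> x y Kx Ky; rewrite normrM ger0_norm//.
apply: (@le_trans _ _ ((p (s + t) - p (s - t)) ^+ 2 / (2 * Num.min p0 p1 ^+ 4) * (n%:R * r ^+ 2))).
  by apply: ler_pM => //; apply: dotp_bounded; [exact: (bKt i3)|exact: (bKt i3)].
rewrite le_eqVlt; apply/orP; left; apply/eqP; rewrite /C /p; field.
by rewrite gt_eqF.
Qed.

Lemma interp_rational (m : R) (N k : nat) : 0 < m -> (0 < N)%N -> (k <= N)%N ->
  (m%:E <= interp 0)%E -> (m%:E <= interp 1)%E -> (m%:E <= interp (k%:R / N%:R))%E.
Proof.
move=> m0 N0 kN m_0 m_1.
have Fpos s : 0 <= s <= 1 -> 0 < fine (interp s).
  move=> s01; apply: fine_gt0; rewrite ltey_eq (finK s01) andbT.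
  case/andP: (s01) => s0; rewrite le_eqVlt => /orP[/eqP ->|s1].
    by apply: lt_le_trans m_1; rewrite lte_fin.
  by apply: posK; [rewrite s0|apply: lt_le_trans m_0; rewrite lte_fin].
have i0 : 0 <= (0 : R) <= 1 by rewrite lexx ler01.
have i1 : 0 <= (1 : R) <= 1 by rewrite lexx ler01.
have ik : 0 <= (k%:R / N%:R : R) <= 1.
  by rewrite divr_ge0//= ler_pdivrMr ?ltr0n// mul1r ler_nat.
have leK (s a : R) : 0 <= s <= 1 -> (a%:E <= interp s)%E = (a <= fine (interp s)).
  by move=> s01; rewrite -[in LHS](fineK (finK s01)) lee_fin.
rewrite (leK _ _ i0) in m_0; rewrite (leK _ _ i1) in m_1; rewrite (leK _ _ ik).
apply: (le_rational_of_defect (f := fun s => fine (interp s)) C_ge0 m0 N0 kN Fpos _ m_0 m_1).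
move=> {m_0 m_1 Fpos} s t st0 t0 st1 Ct.
have i2 : 0 <= s + t <= 1 by apply/andP; split; lra.
have i3 : 0 <= s - t <= 1 by apply/andP; split; lra.
have i4 : 0 <= s <= 1 by apply/andP; split; lra.
rewrite expr2; have := interp_defect st0 t0 st1 Ct.
rewrite -(fineK (finK i2)) -(fineK (finK i3)) -(fineK (finK i4)) -!EFinM lee_fin.
by move=> H; exact: H.
Qed.

End interpolation.

(** * The Gaussian measure as an outer measure *)

Section gaussian_measure.
Context {R : realType} {n : nat}.
Local Notation V := 'rV[R]_n.
Local Notation mu := (lebesgue_rV R n).
Local Notation mR := (measurableTypeR R).

Definition gpdf (x : V) : R := \prod_i normal_pdf 0 1 (x ord0 i).

Lemma gpdf_ge0 x : 0 <= gpdf x.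
Proof. by apply: prodr_ge0 => i _; exact: normal_pdf_ge0. Qed.

Lemma measurable_gpdf : measurable_fun setT (fun x => (gpdf x)%:E).
Proof.
apply/measurable_EFinP; apply: measurable_prod => i _.
exact: measurableT_comp (measurable_normal_pdf _ _) (measurable_rv_coor i).
Qed.

Lemma normal_pdf01E (t : R) :
  normal_pdf 0 1 t = normal_peak 1 * expR (- (1 / 2) * t ^+ 2).
Proof.
rewrite normal_pdfE ?oner_eq0// /normal_fun subr0 expr1n.
by congr (_ * expR _); field.
Qed.

Lemma gpdfE x : gpdf x = normal_peak 1 ^+ n * gwt 1 x.
Proof.
rewrite /gpdf; under eq_bigr do rewrite normal_pdf01E.
rewrite big_split/= prodr_const card_ord; congr (_ * _).
by rewrite /gwt /nrm2 mulr_sumr expR_sum.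
Qed.

(** The countably additive counterpart of [gauss_measure], given by the density; the two agree on
    boxes. *)
Definition gaussian (A : set V) : \bar R := (\int[mu]_(x in A) (gpdf x)%:E)%E.

Let gaussian0 : gaussian set0 = 0%E. Proof. by rewrite /gaussian integral_set0. Qed.

Let gaussian_ge0 A : (0 <= gaussian A)%E.
Proof. by apply: integral_ge0 => x _; rewrite lee_fin gpdf_ge0. Qed.

Let gaussian_sigma_additive : semi_sigma_additive gaussian.
Proof.
move=> F mF tF mUF; rewrite /gaussian ge0_integral_bigcup//.
- apply: is_cvg_ereal_nneg_natsum_cond => k _ _.
  by apply: integral_ge0 => x _; rewrite lee_fin gpdf_ge0.
- by apply: measurable_funTS; exact: measurable_gpdf.
- by move=> x _; rewrite lee_fin gpdf_ge0.
Qed.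

HB.instance Definition _ := isMeasure.Build _ _ _ gaussian gaussian0 gaussian_ge0 gaussian_sigma_additive.

Lemma gaussian_indic A : measurable A -> gaussian A = (\int[mu]_x (\1_A x * gpdf x)%:E)%E.
Proof.
move=> mA; rewrite /gaussian integral_mkcond; apply: eq_integral => x _.
rewrite patchE indicE; case: ifPn => xA; first by rewrite mul1r.
by rewrite mul0r.
Qed.

Lemma gaussianE A : measurable A -> gaussian A = ((normal_peak 1 ^+ n)%:E * gint 1 A)%E.
Proof.
move=> mA; rewrite gaussian_indic// /gint.
have p0 : (0%R <= (normal_peak (1 : R) ^+ n)%:E)%E by rewrite lee_fin exprn_ge0// normal_peak_ge0.
have g0 (x : V) : [set: V] x -> (0%R <= (\1_A x * gwt 1 x)%:E)%E.
  by rewrite lee_fin mulr_ge0 ?gwt_ge0.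
rewrite -(ge0_integralZl mu measurableT (measurable_gint_fun 1 mA) g0 p0).
by apply: eq_integral => x _; rewrite gpdfE -EFinM mulrCA.
Qed.

Lemma gaussian_box (a b : V) : gaussian (box a b) = (box_gauss a b)%:E.
Proof.
rewrite gaussian_indic; last exact: measurable_box.
pose f (i : 'I_n) : mR -> R := fun t => \1_([set` `]a ord0 i, b ord0 i]%R] : set mR) t * normal_pdf 0 1 t.
rewrite /box_gauss -(@integral_lebesgue_rV_prod R n f).
- apply: eq_integral => x _; congr EFin; rewrite /f big_split/=; congr (_ * _).
  have [bx|bx] := pselect (box a b x).
    rewrite (indic_in bx) big1// => i _.
    by rewrite indicE mem_set//= in_itv/=; exact: bx.
  rewrite (indic_notin bx); have [i ni] : exists i, ~ (a ord0 i < x ord0 i <= b ord0 i).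
    by apply/existsNP.
  by rewrite (bigD1 i)//= indicE memNset ?mul0r//= in_itv/=.
- move=> i; apply: measurable_funM; first exact: measurable_indic.
  exact: measurable_normal_pdf.
- by move=> i t; rewrite mulr_ge0 ?normal_pdf_ge0.
move=> i; rewrite fineK; last by apply: fin_num_measure.
rewrite /normal_prob [RHS]integral_mkcond; apply: eq_integral => t _.
rewrite patchE /f indicE; case: ifPn => xA; first by rewrite mul1r.
by rewrite mul0r.
Qed.

Lemma gaussian_setT : gaussian setT = 1%E.
Proof.
rewrite /gaussian /gpdf (@integral_lebesgue_rV_prod R n (fun _ => normal_pdf 0 1) (fun _ => 1)).
- by rewrite big1.
- by move=> i; exact: measurable_normal_pdf.
- by move=> i t; exact: normal_pdf_ge0.
- by move=> i; rewrite integral_normal_pdf.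
Qed.

Lemma gaussian_le (A B : set V) : measurable A -> measurable B -> A `<=` B -> (gaussian A <= gaussian B)%E.
Proof. by move=> mA mB AB; apply: le_measure; rewrite ?inE. Qed.

Lemma gaussian_fin A : measurable A -> gaussian A \is a fin_num.
Proof.
move=> mA; rewrite ge0_fin_numE ?gaussian_ge0//; apply: (@le_lt_trans _ _ (gaussian setT)).
  exact: gaussian_le.
by rewrite gaussian_setT ltry.
Qed.

Lemma gauss_measure_ge0 (A : set V) : (0 <= gauss_measure A)%E.
Proof.
apply: le_ereal_inf_tmp => _ [ab _ <-]; apply: nneseries_ge0 => k _ _.
rewrite lee_fin; apply: prodr_ge0 => i _; apply: fine_ge0; exact: measure_ge0.
Qed.

(** Countable subadditivity over each admissible cover. With [gauss_measure_le_thicken] this is all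
    that is used to compare the two measures. *)
Lemma gaussian_le_gauss_measure (A B : set V) : measurable A -> A `<=` B ->
  (gaussian A <= gauss_measure B)%E.
Proof.
move=> mA AB; apply: le_ereal_inf_tmp => _ [ab cover <-].
under eq_eseriesr do rewrite -gaussian_box.
apply: (@measure_sigma_subadditive _ _ _ gaussian) => //.
- by move=> k; exact: measurable_box.
- exact: subset_trans cover.
Qed.

Definition thicken (h : R) (K : set V) : set V := [set x | exists2 y, K y & near_pt h y x].

Lemma cube_open_thicken h K : cube_open (thicken h K).
Proof.
move=> x [y Ky yx].
have [d d0 dh] : exists2 d, 0 < d & forall i, `|x ord0 i - y ord0 i| + d <= h.
  (* The admissible radius comes from the largest coordinate distance, so the case without
     coordinates is set apart. *)
  have [i0|] := pselect (exists i0 : 'I_n, true); last first.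
    move=> ni; exists 1 => // i; exfalso; apply: ni; by exists i.
  case: i0 => i0 _.
  have [j _ jmax] := @arg_maxP _ _ _ i0 xpredT (fun i => `|x ord0 i - y ord0 i|) isT.
  exists (h - `|x ord0 j - y ord0 j|); first by rewrite subr_gt0; exact: yx.
  by move=> i; have := jmax i isT; rewrite /= => ?; lra.
exists d => // z xz; exists y => // i.
have -> : z ord0 i - y ord0 i = (z ord0 i - x ord0 i) + (x ord0 i - y ord0 i) by ring.
by apply: le_lt_trans (ler_normD _ _) _; have := xz i; have := dh i; lra.
Qed.

(** The cells of mesh [h] that meet [K] cover it, are disjoint and stay within [h] of [K]: their
    total mass is the measure of a subset of the neighbourhood. *)
Lemma gauss_measure_le_thicken (h : R) (K : set V) : (0 < n)%N -> 0 < h ->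
  (gauss_measure K <= gaussian (thicken h K))%E.
Proof.
move=> n0 h0; have mT := measurable_cube_open (@cube_open_thicken h K).
pose ab k : V * V := if pickle_inv k is Some z then
   if `[< exists2 x, K x & cell h z x >] then (cell_lo h z, cell_hi h z) else (0, 0)
  else (0, 0).
(* Indices without a cell receive this dummy box. It is empty because [0 < n]; in dimension 0 it
   would be the whole space. *)
have box00 : box (0 : V) 0 = set0.
  apply/seteqP; split => // x bx; have := bx (Ordinal n0).
  by rewrite mxE => /andP[p q]; move: (lt_le_trans p q); rewrite ltxx.
have subc k : box (ab k).1 (ab k).2 `<=` celln h k.
  rewrite /ab /celln; case: pickle_inv => [z|]; last by rewrite box00.
  by case: asboolP => _ /=; rewrite ?box00.
have cover : K `<=` \bigcup_k box (ab k).1 (ab k).2.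
  move=> x Kx; have [z zx] := cell_cover x h0; exists (pickle z) => //.
  rewrite /ab pickleK_inv; case: asboolP => //= ne; exfalso; apply: ne.
  by exists x.
apply: (@le_trans _ _ (\sum_(0 <= k <oo) (box_gauss (ab k).1 (ab k).2)%:E)%E).
  apply: ge_ereal_inf; exists (\sum_(0 <= k <oo) (box_gauss (ab k).1 (ab k).2)%:E)%E => //.
  by exists (fun k => (ab k).1, fun k => (ab k).2).
under eq_eseriesr do rewrite -gaussian_box.
have mb k : measurable (box (ab k).1 (ab k).2) by exact: measurable_box.
have tb : trivIset setT (fun k => box (ab k).1 (ab k).2).
  apply/trivIsetP => k l _ _ kl; rewrite -subset0 => x [xk xl].
  have /trivIsetP/(_ k l I I kl) := trivIset_celln (n := n) h0.
  by rewrite -subset0; apply; split; apply: subc.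
apply: (@le_trans _ _ (gaussian (\bigcup_k box (ab k).1 (ab k).2))).
  rewrite (measure_bigcup gaussian)// le_eqVlt; apply/orP; left; apply/eqP.
  by apply: eq_eseriesl => k; rewrite in_setT.
apply: gaussian_le => //; first exact: bigcupT_measurable.
move=> x [k _]; rewrite /ab; case: pickle_inv => [z|]; last by rewrite box00.
case: asboolP => [[y Ky zy]|_] /=; last by rewrite box00.
by move=> zx; exists y => //; exact: (cell_near zy zx h0).
Qed.

End gaussian_measure.

(** * Gaussian measure of slabs *)

Section slab.
Context {R : realType}.
Local Notation mR := (measurableTypeR R).
Local Notation leb := (@lebesgue_measure R).

Definition slab n (xi : 'rV[R]_n) (c h : R) : set 'rV[R]_n :=
  [set x | `|dotp xi x + c| <= h].

Lemma measurable_slab n (xi : 'rV[R]_n) c h : measurable (slab xi c h).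
Proof.
have mf : measurable_fun setT (fun x => dotp xi x + c : mR).
  by apply: measurable_funD => //; apply: measurable_dotp => //; exact: measurable_cst.
have := mf measurableT _ (measurable_itv `[- h, h]%R); rewrite setTI; congr measurable.
by apply/seteqP; split => x; rewrite /slab /= in_itv/= -ler_norml.
Qed.

Lemma dotp_vcons n (xi : 'rV[R]_n.+1) t x :
  dotp xi (vcons t x) = xi ord0 ord0 * t + dotp (\row_j xi ord0 (lift ord0 j)) x.
Proof.
rewrite /dotp big_ord_recl vcons0; congr (_ + _).
by apply: eq_bigr => i _; rewrite vconsS mxE.
Qed.

Lemma gpdf_vcons n t (x : 'rV[R]_n) : gpdf (vcons t x) = normal_pdf 0 1 t * gpdf x.
Proof.
rewrite /gpdf big_ord_recl vcons0; congr (_ * _).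
by apply: eq_bigr => i _; rewrite vconsS.
Qed.

Lemma affine_itv (a c h : R) : a != 0 -> exists p q, q - p = 2 * h / `|a| /\
  [set t : mR | `|a * t + c| <= h] = [set` `[p, q]%R].
Proof.
move=> a0; have aa : 0 < `|a| by rewrite normr_gt0.
exists (- c / a - h / `|a|), (- c / a + h / `|a|); split; first by field; rewrite gt_eqF.
have E (t : R) : (`|a * t + c| <= h) = (`|t - - c / a| <= h / `|a|).
  rewrite ler_pdivlMr// -normrM; congr (`| _ | <= h); field; exact: a0.
by apply/seteqP; split => t /=; rewrite in_itv/= E ler_distl.
Qed.

Lemma normal_slab (a c h : R) : a != 0 -> 0 <= h ->
  (\int[leb]_t (\1_[set t : mR | (`|a * t + c| <= h)%R] t * normal_pdf 0 1 t)%:E <=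
   (normal_peak 1 * (2 * h / `|a|))%:E)%E.
Proof.
move=> a0 h0.
have aa : 0 < `|a| by rewrite normr_gt0.
have [p [q [pq S]]] := affine_itv c h a0.
rewrite S.
have mS : measurable ([set` `[p, q]%R] : set mR) by exact: measurable_itv.
have pk := normal_peak_ge0 (1 : R).
apply: (@le_trans _ _ (\int[leb]_t ((normal_peak 1)%:E * (\1_([set` `[p, q]%R] : set mR) t)%:E))%E).
  apply: ge0_le_integral => //.
  - by move=> t _; rewrite lee_fin mulr_ge0 ?normal_pdf_ge0.
  - apply/measurable_EFinP; apply: measurable_funM; first exact: measurable_indic.
    exact: measurable_normal_pdf.
  - by apply: measurable_funeM; apply/measurable_EFinP; exact: measurable_indic.
  - move=> t _; rewrite -EFinM lee_fin mulrC; apply: ler_wpM2r => //.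
    by apply: normal_pdf_ub; rewrite oner_eq0.
rewrite ge0_integralZl//; last first.
  by apply/measurable_EFinP; exact: measurable_indic.
rewrite integral_indic// setIT EFinM; apply: lee_wpmul2l; first by rewrite lee_fin.
rewrite /= lebesgue_measure_itv/=; case: ifP => _; first by rewrite -EFinD lee_fin pq.
by rewrite lee_fin divr_ge0 ?mulr_ge0// ltW.
Qed.

(** The two readings serve the two orders of integration: at fixed [t] the section is a slab in one
    dimension less, at fixed [x] an interval. *)
Lemma indic_slab_vcons n (xi : 'rV[R]_n.+1) c h t (x : 'rV[R]_n) :
  let xi' := \row_j xi ord0 (lift ord0 j) in
  (\1_(slab xi c h) (vcons t x) = \1_(slab xi' (xi ord0 ord0 * t + c) h) x :> R) *
  (\1_(slab xi c h) (vcons t x) =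
   \1_[set t : mR | `|xi ord0 ord0 * t + (dotp xi' x + c)| <= h] t :> R).
Proof.
move=> xi'.
have E1 : dotp xi (vcons t x) + c = dotp xi' x + (xi ord0 ord0 * t + c).
  by rewrite dotp_vcons; ring.
have E2 : dotp xi (vcons t x) + c = xi ord0 ord0 * t + (dotp xi' x + c).
  by rewrite dotp_vcons; ring.
split; rewrite !indicE; congr (_%:R); congr nat_of_bool.
  by apply/idP/idP; rewrite !inE /slab /= E1.
by apply/idP/idP; rewrite !inE /slab /= E2.
Qed.

(** Along coordinate [i] the slab cuts intervals of length [2 h / |xi_i|], on which the density is
    at most its peak; the other coordinates have total mass 1. If [i] is the first coordinate it is
    integrated innermost; otherwise fixing the first coordinate only shifts the offset, which is why
    [c] varies in the induction. *)
Lemma gaussian_slab n (xi : 'rV[R]_n) (i : 'I_n) (c h : R) : xi ord0 i != 0 -> 0 <= h ->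
  (gaussian (slab xi c h) <= (normal_peak 1 * (2 * h / `|xi ord0 i|))%:E)%E.
Proof.
elim: n xi i c => [|n IH] xi i c; first by case: i.
move=> xii h0; rewrite gaussian_indic; last exact: measurable_slab.
set K := (X in (_ <= X%:E)%E).
have mf : measurable_fun setT (fun x : 'rV[R]_n.+1 => (\1_(slab xi c h) x * gpdf x)%:E).
  have mg := @measurable_gpdf R n.+1.
  under eq_fun do rewrite EFinM.
  apply: emeasurable_funM => //; apply/measurable_EFinP; apply: measurable_indic.
  exact: measurable_slab.
have f0 (x : 'rV[R]_n.+1) : (0%R <= (\1_(slab xi c h) x * gpdf x)%:E)%E.
  by rewrite lee_fin mulr_ge0 ?gpdf_ge0.
pose xi' : 'rV[R]_n := \row_j xi ord0 (lift ord0 j).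
have K0 : (0%R <= K%:E)%E.
  by rewrite lee_fin mulr_ge0 ?normal_peak_ge0// divr_ge0// mulr_ge0.
have one_n := @gaussian_setT R n; rewrite /gaussian in one_n.
have one_1 := @integral_normal_pdf R 0 1.
have mft (t : R) : measurable_fun setT (fun x : 'rV[R]_n => (\1_(slab xi c h) (vcons t x) * gpdf (vcons t x))%:E).
  by apply: (measurableT_comp mf); exact: measurable_vcons_fun.
have mfx (x : 'rV[R]_n) : measurable_fun setT (fun t : mR => (\1_(slab xi c h) (vcons t x) * gpdf (vcons t x))%:E).
  by apply: (measurableT_comp mf); exact: measurable_vcons_fun.
have mN : measurable_fun setT (fun t : mR => (normal_pdf 0 1 t)%:E).
  by apply/measurable_EFinP; exact: measurable_normal_pdf.
have N0 (t : mR) : (0%R <= (normal_pdf 0 1 t)%:E)%E by rewrite lee_fin normal_pdf_ge0.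
have G0 (x : 'rV[R]_n) : (0%R <= (gpdf x)%:E)%E by rewrite lee_fin gpdf_ge0.
case: (unliftP ord0 i) xii => [j|] iE xii; last first.
  rewrite (integral_lebesgue_rVS_swap mf f0).
  apply: (@le_trans _ _ (\int[lebesgue_rV R n]_x (K%:E * (gpdf x)%:E))%E); last first.
    rewrite (ge0_integralZl (lebesgue_rV R n) measurableT (@measurable_gpdf R n))//.
    by rewrite one_n mule1.
  apply: ge0_le_integral => //.
  - by move=> x _; apply: integral_ge0 => t _; exact: f0.
  - have mfv : measurable_fun setT (fun p : 'rV[R]_n * mR =>
        (\1_(slab xi c h) (vcons p.2 p.1) * gpdf (vcons p.2 p.1))%:E).
      have mvc : measurable_fun setT (fun p : 'rV[R]_n * mR => vcons p.2 p.1).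
        by apply: measurable_vcons_fun => //; exact: measurable_snd.
      exact: (measurableT_comp mf mvc).
    by apply: (measurable_fun_fubini_tonelli_F _ mfv) => p; exact: f0.
  - by apply: measurable_funeM; exact: measurable_gpdf.
  move=> x _.
  have xi0 : xi ord0 ord0 != 0 by rewrite -iE.
  have := normal_slab (dotp xi' x + c) xi0 h0.
  have -> : normal_peak 1 * (2 * h / `|xi ord0 ord0|) = K by rewrite /K iE.
  move=> Hle.
  apply: le_trans (lee_wpmul2r (G0 x) Hle).
  have m1 : measurable_fun setT (fun t : mR =>
      (\1_[set t : mR | `|xi ord0 ord0 * t + (dotp xi' x + c)| <= h] t * normal_pdf 0 1 t)%:E).
    apply/measurable_EFinP; apply: measurable_funM; last exact: measurable_normal_pdf.
    have [p [q [_ ->]]] := affine_itv (dotp xi' x + c) h xi0.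
    by apply: measurable_indic; exact: measurable_itv.
  rewrite -(ge0_integralZr leb measurableT m1 _ (G0 x)); last first.
    by move=> t _; rewrite lee_fin mulr_ge0// normal_pdf_ge0.
  apply: ge0_le_integral => //.
  - exact: (emeasurable_funM m1 (measurable_cst ((gpdf x)%:E : \bar R))).
  by move=> t _; rewrite -EFinM lee_fin gpdf_vcons mulrA (indic_slab_vcons xi c h t x).2.
rewrite (integral_lebesgue_rVS mf f0).
apply: (@le_trans _ _ (\int[leb]_t (K%:E * (normal_pdf 0 1 t)%:E))%E); last first.
  by rewrite (ge0_integralZl leb measurableT mN)// one_1 mule1.
apply: ge0_le_integral => //.
- by move=> x _; apply: integral_ge0 => t _; exact: f0.
- exact: (measurable_integral_vcons mf f0).
- by apply: measurable_funeM.
move=> t _.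
have xij : xi' ord0 j != 0 by rewrite mxE -iE.
have := IH xi' j (xi ord0 ord0 * t + c) xij h0.
rewrite gaussian_indic; last exact: measurable_slab.
have -> : normal_peak 1 * (2 * h / `|xi' ord0 j|) = K by rewrite /K iE mxE.
move=> Hle.
apply: le_trans (lee_wpmul2r (N0 t) Hle).
have m1 : measurable_fun setT (fun x : 'rV[R]_n =>
    (\1_(slab xi' (xi ord0 ord0 * t + c) h) x * gpdf x)%:E).
  under eq_fun do rewrite EFinM.
  apply: emeasurable_funM; last exact: measurable_gpdf.
  by apply/measurable_EFinP; apply: measurable_indic; exact: measurable_slab.
rewrite -(ge0_integralZr (lebesgue_rV R n) measurableT m1 _ (N0 t)); last first.
  by move=> x _; rewrite lee_fin mulr_ge0// gpdf_ge0.
apply: ge0_le_integral => //.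
- exact: (emeasurable_funM m1 (measurable_cst ((normal_pdf 0 1 t)%:E : \bar R))).
move=> x _; rewrite -EFinM lee_fin gpdf_vcons [normal_pdf 0 1 t * _]mulrC mulrA.
by rewrite (indic_slab_vcons xi c h t x).1.
Qed.

End slab.

(** * Symmetric convex sets: a cube inside or a hyperplane around *)

Section dichotomy.
Context {R : realType} {n : nat}.
Local Notation V := 'rV[R]_n.

Lemma cvx_scale (K : set V) (s : R) x : cvx K -> K 0 -> K x -> 0 <= s <= 1 -> K (s *: x).
Proof. by move=> cK K0 Kx s01; have := cK _ _ Kx K0 _ s01; rewrite scaler0 addr0. Qed.

(** Symmetry absorbs the signs of the coefficients, and the point 0 the mass missing from a total
    below 1. *)
Lemma absolutely_convex_comb (K : set V) k (x : 'I_k -> V) (c : 'I_k -> R) :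
  cvx K -> symm K -> K 0 -> (forall i, K (x i)) -> \sum_i `|c i| <= 1 ->
  K (\sum_i c i *: x i).
Proof.
move=> cK sK K0 Kx c1.
suff [z Kz ->] : exists2 z, K z & \sum_i c i *: x i = (\sum_i `|c i|) *: z.
  by apply: cvx_scale => //; rewrite c1 sumr_ge0.
elim: k x c Kx {c1} => [|k IH] x c Kx; first by exists 0; rewrite // !big_ord0 scaler0.
have [z Kz zE] := IH (fun i => x (lift ord0 i)) (fun i => c (lift ord0 i)) (fun i => Kx _).
have [y Ky yE] : exists2 y, K y & c ord0 *: x ord0 = `|c ord0| *: y.
  have [c0|c0] := leP 0 (c ord0); first by exists (x ord0); rewrite // ger0_norm.
  by exists (- x ord0); [exact: sK|rewrite ltr0_norm// scalerN scaleNr opprK].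
have s0 : 0 <= \sum_i `|c (lift ord0 i)| by rewrite sumr_ge0.
have [w Kw wE] := cvx_comb cK Ky Kz (normr_ge0 (c ord0)) s0.
by exists w => //; rewrite !big_ord_recl zE yE wE.
Qed.

(** Take a free family in [K] of maximal length; its span contains [K]. With fewer than [n] vectors,
    some non-zero vector is orthogonal to the span. With [n] vectors it is a basis, and points near
    0 have coordinates of small absolute sum. *)
Lemma cube_or_hyperplane (K : set V) : cvx K -> symm K -> K 0 ->
  (exists2 r : R, 0 < r & forall x : V, (forall i, `|x ord0 i| <= r) -> K x) \/
  (exists (xi : V) i, xi ord0 i != 0 /\ forall x, K x -> dotp xi x = 0).
Proof.
move=> cK sK K0.
pose P k := `[< exists X : k.-tuple V, free X /\ forall i, K (tnth X i) >].
have exP : exists k, P k.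
  by exists 0%N; apply/asboolP; exists [tuple]; split; [exact: nil_free|case].
have dimE : \dim {:V} = n by rewrite dimvf /dim/= mul1n.
have Pn k : P k -> (k <= n)%N.
  move=> /asboolP[X [fX _]]; move: fX; rewrite /free size_tuple => /eqP <-.
  by rewrite -[leqRHS]dimE dimvS// subvf.
case: (ex_maxnP exP Pn) => k /asboolP[X [fX KX]] kmax.
have span x : K x -> x \in <<X>>%VS.
  move=> Kx; apply/negPn/negP => nx.
  have : (k.+1 <= k)%N; last by rewrite ltnn.
  apply: kmax; apply/asboolP; exists [tuple of x :: X]; split.
    by rewrite free_cons nx.
  move=> i; case: (unliftP ord0 i) => [j|] ->; last by rewrite tnth0.
  by rewrite tnthS.
have [kn|kn] := eqVneq k n; last first.
  right.
  have kn' : (k < n)%N by rewrite ltn_neqAle kn Pn//; apply/asboolP; exists X.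
  pose A : 'M[R]_(k, n) := \matrix_(i, j) tnth X i ord0 j.
  (* The rows of [A] are the family, so any non-zero column of the cokernel is a normal vector to
     its span. *)
  have cok : cokermx A != 0.
    rewrite -mxrank_eq0 mxrank_coker -lt0n subn_gt0.
    exact: leq_ltn_trans (rank_leq_row A) kn'.
  have [i [j cij]] : exists i j, cokermx A i j != 0.
    have [//|/existsNP[i /existsNP[j /eqP cij]]] := pselect (forall i j, cokermx A i j = 0).
      by move=> c0; move/eqP: cok; case; apply/matrixP => i j; rewrite c0 mxE.
    by exists i, j.
  exists (\row_l cokermx A l j), i; split; first by rewrite mxE.
  move=> x /span /coord_span ->.
  have Xz (l : 'I_k) : dotp (\row_l cokermx A l j) X`_l = 0.
    have := congr1 (fun B : 'M[R]_(k, n) => B l j) (mulmx_coker A); rewrite !mxE => <-.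
    by apply: eq_bigr => m _; rewrite !mxE mulrC (tnth_nth 0).
  rewrite /dotp; under eq_bigr do rewrite summxE mulr_sumr.
  rewrite exchange_big/= big1// => l _.
  have := Xz l; rewrite /dotp => xz.
  under eq_bigr => i0 _ do rewrite [fun_of_matrix (_ *: _) _ _]mxE mulrCA.
  by rewrite -mulr_sumr xz mulr0.
left.
have full : <<X>>%VS = fullv.
  apply/eqP; rewrite eqEdim subvf/=.
  by move: fX; rewrite /free size_tuple => /eqP ->; rewrite [leqLHS]dimE kn.
(* [T] bounds the absolute sum of the coordinates of any vector in the unit cube; the radius is
   [1 / (1 + T)], defined even if [T] is 0. *)
pose T := \sum_(i < k) \sum_(l < n) `|coord X i (delta_mx 0 l)|.
have T0 : 0 <= T by apply: sumr_ge0 => i _; exact: sumr_ge0.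
exists (1 + T)^-1; first by rewrite invr_gt0; lra.
move=> x xr.
have xX : x \in <<X>>%VS by rewrite full memvf.
rewrite (coord_span xX).
have -> : \sum_(i < k) coord X i x *: X`_i = \sum_(i < k) coord X i x *: tnth X i.
  by apply: eq_bigr => i _; rewrite (tnth_nth 0).
apply: absolutely_convex_comb => //.
apply: (@le_trans _ _ (\sum_(i < k) \sum_(l < n) (1 + T)^-1 * `|coord X i (delta_mx 0 l)|)).
  apply: ler_sum => i _.
  rewrite [x in coord X i x]row_sum_delta linear_sum/=.
  apply: (le_trans (ler_norm_sum _ _ _)); apply: ler_sum => l _.
  by rewrite linearZ/= normrM; apply: ler_wpM2r.
under eq_bigr do rewrite -mulr_sumr.
rewrite -mulr_sumr -/T mulrC ler_pdivrMr; lra.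
Qed.

End dichotomy.

(** * Neighbourhoods of convex sets *)

Section thickening.
Context {R : realType} {n : nat}.
Local Notation V := 'rV[R]_n.

Lemma convex_cvx (K : set V) : convex K -> cvx K.
Proof.
move=> cK x y Kx Ky t /andP[t0 t1].
by have := cK x y (Itv01 t0 t1) (mem_set Kx) (mem_set Ky); rewrite inE.
Qed.

Lemma conv_lt (h t x y : R) : 0 <= t <= 1 -> `|x| < h -> `|y| < h ->
  `|t * x + (1 - t) * y| < h.
Proof.
move=> /andP[t0 t1] xh yh; apply: le_lt_trans (ler_normD _ _) _.
have t1' : 0 <= 1 - t by rewrite subr_ge0.
rewrite !normrM (ger0_norm t0) (ger0_norm t1').
have h2 := ler_wpM2l t1' (ltW yh).
move: t0; rewrite le_eqVlt => /orP[/eqP <-|t0]; first by rewrite mul0r add0r subr0 mul1r.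
have : t * `|x| < t * h by rewrite ltr_pM2l.
lra.
Qed.

Lemma sub_thicken h (K : set V) : 0 < h -> K `<=` thicken h K.
Proof. by move=> h0 x Kx; exists x => // i; rewrite subrr normr0. Qed.

Lemma mink_sum_thicken h t (K L : set V) : 0 <= t <= 1 ->
  mink_sum t (1 - t) (thicken h K) (thicken h L) `<=` thicken h (mink_sum t (1 - t) K L).
Proof.
move=> t01 _ [x [y [[x' Kx' xx'] [y' Ly' yy'] ->]]].
exists (t *: x' + (1 - t) *: y'); first by exists x', y'.
move=> i; rewrite !mxE opprD addrACA -!mulrBr.
by apply: conv_lt.
Qed.

Lemma cvx_thicken h (K : set V) : cvx K -> cvx (thicken h K).
Proof.
move=> cK x y hx hy t t01.
have [|z [a [b [Ka Kb ->]]] zn] := @mink_sum_thicken h t K K t01 (t *: x + (1 - t) *: y).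
  by exists x, y.
by exists (t *: a + (1 - t) *: b) => //; exact: cK.
Qed.

Lemma symm_thicken h (K : set V) : symm K -> symm (thicken h K).
Proof.
move=> sK x [y Ky yx]; exists (- y); first exact: sK.
by move=> i; rewrite !mxE -opprD normrN; exact: yx.
Qed.

(** If [x] is within [h] of [y] in [K], then [(r / h) (x - y)] lies in the cube, and
    [x / (1 + h / r)] is its convex combination with [y], with weight [r / (r + h)] on [y]. *)
Lemma thicken_scale h r (K : set V) x : 0 < h -> 0 < r -> cvx K ->
  (forall y : V, (forall i, `|y ord0 i| <= r) -> K y) ->
  thicken h K x -> K ((1 + h / r)^-1 *: x).
Proof.
move=> h0 r0 cK cube [y Ky yx].
pose s := r / (r + h); have rh : 0 < r + h by rewrite addr_gt0.
have -> : (1 + h / r)^-1 *: x = s *: y + (1 - s) *: ((r / h) *: (x - y)).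
  apply/rowP => i; rewrite !mxE /s; field.
  by rewrite !gt_eqF// addrC.
apply: cK => //.
  apply: cube => i; rewrite !mxE normrM gtr0_norm ?divr_gt0//.
  rewrite mulrAC ler_pdivrMr// ler_pM2l//; exact/ltW/yx.
by rewrite /s divr_ge0 ?(ltW r0) ?(ltW rh)//= ler_pdivrMr// mul1r lerDl ltW.
Qed.

End thickening.

(** * The inequality for symmetric convex sets *)

Section gaussian_brunn_minkowski.
Context {R : realType} {n : nat}.
Hypothesis n0 : (0 < n)%N.
Local Notation V := 'rV[R]_n.

Lemma le_gint_weight (q q' : R) (K : set V) : q <= q' -> measurable K ->
  (gint q' K <= gint q K)%E.
Proof.
move=> qq' mK; apply: ge0_le_integral => //.
- by move=> x _; rewrite lee_fin mulr_ge0 ?gwt_ge0.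
- exact: measurable_gint_fun.
- exact: measurable_gint_fun.
move=> x _; rewrite lee_fin; apply: ler_wpM2l => //.
rewrite ler_expR; apply: ler_wpM2r; first exact: nrm2_ge0.
by rewrite lerN2; apply: ler_wpM2r.
Qed.

Let kappa : R := normal_peak 1 ^+ n.
Let kappa0 : 0 < kappa. Proof. by rewrite exprn_gt0// normal_peak_gt0// oner_eq0. Qed.

(** Volume scales by [c ^ n], while the density decreases along rays from the origin. *)
Lemma gaussian_dilate_ge1 (c : R) (K K' : set V) : 1 <= c -> measurable K -> measurable K' ->
  (forall x, K x <-> K' (c *: x)) -> (gaussian K' <= (c ^+ n)%:E * gaussian K)%E.
Proof.
move=> c1 mK mK' KK'; have c0 : 0 < c by lra.
rewrite !gaussianE// (gint_scale 1 c0 mK' KK') muleCA; apply: lee_wpmul2l.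
  by rewrite lee_fin exprn_ge0// ltW.
apply: lee_wpmul2l; first by rewrite lee_fin ltW.
by apply: le_gint_weight => //; rewrite mul1r exprn_ege1.
Qed.

Lemma gaussian_dilate_le1 (c : R) (K K' : set V) : 0 < c <= 1 -> measurable K -> measurable K' ->
  (forall x, K x <-> K' (c *: x)) -> ((c ^+ n)%:E * gaussian K <= gaussian K')%E.
Proof.
move=> /andP[c0 c1] mK mK' KK'.
rewrite !gaussianE// (gint_scale 1 c0 mK' KK') muleCA; apply: lee_wpmul2l.
  by rewrite lee_fin ltW.
apply: lee_wpmul2l; first by rewrite lee_fin exprn_ge0// ltW.
by apply: le_gint_weight => //; rewrite mul1r exprn_ile1// ltW.
Qed.

(** The relation between [u] and [v] says that the interpolation parameter
    [(1 - l) b / (l a + (1 - l) b)] equals [v / (u + v)], a node of the grid with [u + v] steps. *)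
Lemma gaussian_mink_sum_rational (U W : set V) (r l a b : R) (u v : nat) :
  cube_open U -> cube_open W -> cvx U -> cvx W -> symm U -> symm W -> U 0 -> W 0 ->
  bounded_by r U -> bounded_by r W ->
  0 < l < 1 -> 0 < a -> 0 < b -> (0 < u)%N -> (0 < v)%N ->
  l * a * v%:R = (1 - l) * b * u%:R ->
  ((a ^+ n)%:E <= gaussian U)%E -> ((b ^+ n)%:E <= gaussian W)%E ->
  (((l * a + (1 - l) * b) ^+ n)%:E <= gaussian (mink_sum l (1 - l) U W))%E.
Proof.
move=> oU oW cU cW sU sW U0 W0 bU bW /andP[l0 l1] a0 b0 u0 v0 uv aU bW'.
pose dil (c : R) (K : set V) : set V := [set x | K (c *: x)].
have dil_open c K : 0 < c -> cube_open K -> cube_open (dil c K).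
  move=> c0 oK x Kx; have [d d0 dK] := oK _ Kx; exists (d / c); first exact: divr_gt0.
  move=> y xy; apply: dK => i; rewrite !mxE -mulrBr normrM gtr0_norm// mulrC.
  by rewrite -ltr_pdivlMr//; exact: xy.
have dil_cvx c K : cvx K -> cvx (dil c K).
  by move=> cK x y Kx Ky t t01; rewrite /dil /= scalerDr !scalerA ![c * _]mulrC -!scalerA; exact: cK.
have dil_symm c K : symm K -> symm (dil c K).
  by move=> sK x Kx; rewrite /dil /= scalerN; exact: sK.
have dil0 c K : K 0 -> dil c K 0 by rewrite /dil /= scaler0.
pose r' := Num.max (r / a) (r / b).
have dil_bounded c K : 0 < c -> r / c <= r' -> bounded_by r K -> bounded_by r' (dil c K).
  move=> c0 rc bK x Kx i; apply: le_trans rc; rewrite ler_pdivlMr// mulrC.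
  by have := bK _ Kx i; rewrite !mxE normrM gtr0_norm.
pose U' := dil a U; pose W' := dil b W.
have oU' := dil_open _ _ a0 oU; have oW' := dil_open _ _ b0 oW.
have bU' : bounded_by r' U' by apply: dil_bounded => //; rewrite le_max lexx.
have bW'' : bounded_by r' W' by apply: dil_bounded => //; rewrite le_max lexx orbT.
have a0' : 0 < a^-1 by rewrite invr_gt0.
have b0' : 0 < b^-1 by rewrite invr_gt0.
have c0 : 0 < l * a + (1 - l) * b by rewrite addr_gt0// mulr_gt0// subr_gt0.
set c := l * a + (1 - l) * b in c0 *.
have uvn0 : u%:R + v%:R != 0 :> R by rewrite gt_eqF// addr_gt0// ltr0n.
have un0 : u%:R != 0 :> R by rewrite pnatr_eq0 -lt0n.
have vn0 : v%:R != 0 :> R by rewrite pnatr_eq0 -lt0n.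
pose th : R := v%:R / (u + v)%N%:R.
have thE : th = (1 - l) * b / c.
  rewrite /th natrD; apply/eqP; rewrite (eqr_div _ _ uvn0 (lt0r_neq0 c0)); apply/eqP.
  by rewrite /c mulrDr [v%:R * (l * a)]mulrC uv; ring.
have e1 : c * (1 - th) = l * a by rewrite thE mulrBr mulr1 mulrC divfK ?gt_eqF// /c; ring.
have e2 : c * th = (1 - l) * b by rewrite thE mulrC divfK ?gt_eqF.
have mi : 0 < kappa^-1 by rewrite invr_gt0.
have base (d : R) K : 0 < d -> cube_open K -> ((d ^+ n)%:E <= gaussian K)%E ->
    ((kappa^-1)%:E <= gint (d ^+ 2) (dil d K))%E.
  move=> d0 oK; have mK := measurable_cube_open oK.
  rewrite gaussianE// (gint_scale (K := dil d K) 1 d0 mK)// mul1r muleCA.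
  rewrite -[X in (X <= _)%E]mule1 lee_pmul2l// ?lte_fin ?exprn_gt0// => h.
  by rewrite -(@lee_pmul2l _ kappa%:E)// -EFinM divff ?gt_eqF.
have i0 : ((kappa^-1)%:E <= interp U' W' a^-1 b^-1 0)%E.
  rewrite /interp subr0 mul1r mul0r addr0 exprVn invrK.
  rewrite (_ : mink_sum 1 0 U' W' = U'); first exact: base.
  apply/seteqP; split => x; first by move=> [p [q [Up _ ->]]]; rewrite scale1r scale0r addr0.
  by move=> Ux; exists x, 0; split; [|exact: dil0|rewrite scale1r scale0r addr0].
have i1 : ((kappa^-1)%:E <= interp U' W' a^-1 b^-1 1)%E.
  rewrite /interp subrr mul1r mul0r add0r exprVn invrK.
  rewrite (_ : mink_sum 0 1 U' W' = W'); first exact: base.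
  apply/seteqP; split => x; first by move=> [p [q [_ Wq ->]]]; rewrite scale1r scale0r add0r.
  by move=> Wx; exists 0, x; split; [exact: dil0| |rewrite scale1r scale0r add0r].
have uvN : (0 < u + v)%N by rewrite addn_gt0 u0.
have := interp_rational oU' oW' (dil_cvx _ _ cU) (dil_cvx _ _ cW) (dil_symm _ _ sU)
  (dil_symm _ _ sW) bU' bW'' (dil0 _ _ W0) a0' b0' mi uvN (leq_addl u v) i0 i1.
(* At [th] the deviation is [1 / c] and the interpolated set is the combination of [U] and [W]
   shrunk by [c]; scaling back by [c] restores the standard weight. *)
rewrite -/th /interp; clearbody th.
have -> : (1 - th) / a + th / b = c^-1.
  apply: (mulfI (lt0r_neq0 c0)); rewrite mulrDr !mulrA e1 e2 divff ?gt_eqF//.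
  by rewrite !mulfK ?gt_eqF// addrC subrK.
rewrite exprVn invrK => H.
have oM : cube_open (mink_sum l (1 - l) U W) by apply: cube_open_mink_sum => //; lra.
have mM := measurable_cube_open oM.
have KK' x : mink_sum (1 - th) th U' W' x <-> mink_sum l (1 - l) U W (c *: x).
  split=> [[p [q [Up Wq ->]]]|[p [q [Up Wq E]]]].
    exists (a *: p), (b *: q); split => //.
    by rewrite scalerDr !scalerA e1 e2.
  exists (a^-1 *: p), (b^-1 *: q); split.
  - by rewrite /U' /dil /= scalerA divff ?gt_eqF// scale1r.
  - by rewrite /W' /dil /= scalerA divff ?gt_eqF// scale1r.
  - apply: (@scalerI _ _ c); first by rewrite gt_eqF.
    rewrite E scalerDr !scalerA e1 e2.
    by rewrite !mulfK ?gt_eqF.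
rewrite gaussianE// (gint_scale 1 c0 mM KK') mul1r muleCA -[X in (X <= _)%E]mule1.
apply: lee_wpmul2l; first by rewrite lee_fin exprn_ge0// ltW.
by rewrite -[X in (X <= _)%E](_ : kappa%:E * (kappa^-1)%:E = 1)%E ?lee_pmul2l// -EFinM divff// gt_eqF.
Qed.

Lemma powR_invn_exprn (x : R) : 0 <= x -> (x `^ n%:R^-1) ^+ n = x.
Proof.
move=> x0; rewrite -powR_mulrn ?powR_ge0// -powRrM mulVf ?powRr1//.
by rewrite pnatr_eq0 -lt0n.
Qed.

Lemma gaussian_mink_sum_bounded (U W : set V) (r l a b : R) :
  cube_open U -> cube_open W -> cvx U -> cvx W -> symm U -> symm W -> U 0 -> W 0 ->
  bounded_by r U -> bounded_by r W ->
  0 < l < 1 -> 0 < a -> 0 < b ->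
  ((a ^+ n)%:E <= gaussian U)%E -> ((b ^+ n)%:E <= gaussian W)%E ->
  (((l * a + (1 - l) * b) ^+ n)%:E <= gaussian (mink_sum l (1 - l) U W))%E.
Proof.
move=> oU oW cU cW sU sW U0 W0 bU bW l01 a0 b0 aU bW'.
have /andP[l0 l1] := l01; have l1' : 0 < 1 - l by rewrite subr_gt0.
have mM : measurable (mink_sum l (1 - l) U W).
  by apply: measurable_cube_open; apply: cube_open_mink_sum => //; lra.
rewrite -(fineK (gaussian_fin mM)) lee_fin.
have z0 : 0 <= fine (gaussian (mink_sum l (1 - l) U W)) by apply: fine_ge0; exact: measure_ge0.
have gn := powR_invn_exprn z0; move: gn (powR_ge0 (fine (gaussian (mink_sum l (1 - l) U W))) n%:R^-1).
move: (_ `^ _) => g gn g0.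
have lb0 : 0 < (1 - l) * b by exact: mulr_gt0.
have c0 : 0 <= l * a + (1 - l) * b by rewrite addr_ge0// ?ltW// mulr_gt0.
rewrite -gn lerXn2r ?nnegrE// leNgt; apply/negP => gc.
(* Shrinking [a] slightly to [a'] makes [l * a' / ((1 - l) * b)] rational, so
   that the interpolation parameter lies on a grid. *)
pose lo := Num.max 0 ((g - (1 - l) * b) / l).
have loa : lo < a by rewrite gt_max a0/= ltr_pdivrMr//; lra.
have lo0 : 0 <= lo by rewrite le_max lexx.
have [|q] := @rat_in_itvoo R (l * lo / ((1 - l) * b)) (l * a / ((1 - l) * b)).
  by rewrite ltr_pM2r ?invr_gt0// ltr_pM2l.
rewrite in_itv/= ltr_pdivrMr// ltr_pdivlMr// => /andP[qlo qa].
pose a' := ratr q * ((1 - l) * b) / l.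
have a'a : a' < a by rewrite ltr_pdivrMr// [a * l]mulrC.
have a'lo : lo < a' by rewrite ltr_pdivlMr// [lo * l]mulrC.
have a'0 : 0 < a' by exact: le_lt_trans a'lo.
have q0 : 0 < q.
  rewrite -(ltr0q R) -(pmulr_lgt0 _ lb0); apply: le_lt_trans qlo.
  by rewrite mulr_ge0// ltW.
have qE : ratr q = `|numq q|%N%:R / `|denq q|%N%:R :> R.
  rewrite /ratr; congr (_ / _).
    by rewrite -{1}(gez0_abs (ltW _ : 0 <= numq q)) ?numq_gt0// ?pmulrn.
  by rewrite -{1}(gez0_abs (denq_ge0 q)) ?pmulrn.
have u0 : (0 < `|numq q|)%N by rewrite absz_gt0 gt_eqF// numq_gt0.
have v0 : (0 < `|denq q|)%N by rewrite absz_gt0 denq_neq0.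
have vn0 : `|denq q|%N%:R != 0 :> R by rewrite pnatr_eq0 -lt0n.
have uv : l * a' * `|denq q|%N%:R = (1 - l) * b * `|numq q|%N%:R.
  by rewrite /a' qE; field; rewrite vn0 gt_eqF.
have a'U : ((a' ^+ n)%:E <= gaussian U)%E.
  apply: le_trans aU; rewrite lee_fin lerXn2r ?nnegrE ?ltW//.
have := gaussian_mink_sum_rational oU oW cU cW sU sW U0 W0 bU bW l01 a'0 b0 u0 v0 uv a'U bW'.
rewrite -(fineK (gaussian_fin mM)) lee_fin -gn ler_pXn2r ?nnegrE//; last first.
  by rewrite addr_ge0// ?ltW// mulr_gt0.
apply/negP; rewrite -ltNge.
have : (g - (1 - l) * b) / l < a' by apply: le_lt_trans a'lo; rewrite le_max lexx orbT.
by rewrite ltr_pdivrMr// [a' * l]mulrC; lra.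
Qed.

(** The inequality is strict so that it survives the passage to a large bounded part of the set; the
    value 0 is kept apart because sets are divided by [a]. *)
Definition below_root (a : R) (x : \bar R) := a = 0 \/ 0 < a /\ ((a ^+ n)%:E < x)%E.

(** Continuity from below along an exhaustion by cubes centred at 0, which keep the set open, convex
    and symmetric when it is so. *)
Lemma gaussian_approx (U : set V) (x : R) : cube_open U -> (x%:E < gaussian U)%E ->
  \forall k \near \oo, (x%:E < gaussian (U `&` thicken k%:R [set 0%R]))%E.
Proof.
move=> oU xU; pose F (k : nat) := U `&` thicken (k%:R : R) [set 0].
have mF k : measurable (F k).
  by apply: measurableI; apply: measurable_cube_open => //; exact: cube_open_thicken.
have FU : \bigcup_k F k = U.
  apply/seteqP; split => [x' [k _ []]//|x' Ux'].
  pose s := \sum_i `|x' ord0 i|.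
  exists (Num.trunc s).+1 => //; split=> //; exists 0 => // i.
  rewrite mxE subr0; apply: le_lt_trans (truncnS_gt s).
  by rewrite /s (bigD1 i)//= lerDl sumr_ge0.
have ndF : {homo F : k m / (k <= m)%N >-> (k <= m)%O}.
  move=> k m km; apply/subsetPset => y [Uy [z -> zy]]; split=> //; exists 0 => // i.
  by apply: lt_le_trans (zy i) _; rewrite ler_nat.
have := @nondecreasing_cvg_mu _ _ _ gaussian F mF _ ndF.
rewrite FU => /(_ (measurable_cube_open oU)) cv.
exact: (cv _ (open_ereal_gt' xU)).
Qed.

Lemma gaussian_mink_sum (U W : set V) (l a b : R) :
  cube_open U -> cube_open W -> cvx U -> cvx W -> symm U -> symm W -> U 0 -> W 0 ->
  0 < l < 1 -> below_root a (gaussian U) -> below_root b (gaussian W) ->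
  (((l * a + (1 - l) * b) ^+ n)%:E <= gaussian (mink_sum l (1 - l) U W))%E.
Proof.
move=> oU oW cU cW sU sW U0 W0 l01.
have /andP[l0 l1] := l01; have l1' : 0 < 1 - l by rewrite subr_gt0.
have mM (U' W' : set V) : cube_open U' -> cube_open W' -> measurable (mink_sum l (1 - l) U' W').
  by move=> oU' oW'; apply: measurable_cube_open; apply: cube_open_mink_sum => //; lra.
(* When one root is 0, the combination contains a dilate of the other set because 0 lies in the
   first, and a dilation by [t <= 1] loses at most [t ^ n]. *)
have one (t s : R) (K L : set V) (d : R) : 0 < t <= 1 -> cube_open K -> L 0 ->
    measurable (mink_sum t s K L) -> 0 < d -> ((d ^+ n)%:E < gaussian K)%E ->
    (((t * d) ^+ n)%:E <= gaussian (mink_sum t s K L))%E.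
  move=> t01 oK L0 mKL d0 dK; have /andP[t0 t1] := t01.
  have mt0 : measurable (mink_sum t 0 K L).
    by apply: measurable_cube_open; exact: cube_open_mink_suml.
  have KK' x : K x <-> mink_sum t 0 K L (t *: x).
    split=> [Kx|[p [q [Kp _ E]]]]; first by exists x, 0; rewrite scale0r addr0.
    by move: E; rewrite scale0r addr0 => /(scalerI (lt0r_neq0 t0)) ->.
  apply: (@le_trans _ _ (gaussian (mink_sum t 0 K L))); last first.
    apply: gaussian_le => // x [p [q [Kp _ ->]]]; exists p, 0; split=> //.
    by rewrite scale0r scaler0.
  apply: le_trans (gaussian_dilate_le1 t01 (measurable_cube_open oK) mt0 KK').
  by rewrite exprMn EFinM; apply: lee_wpmul2l (ltW dK); rewrite lee_fin exprn_ge0// ltW.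
move=> [->|[a0 aU]] [->|[b0 bW]].
- by rewrite !mulr0 addr0 expr0n (gtn_eqF n0)/= measure_ge0.
- rewrite mulr0 add0r mink_sumC; apply: one => //; first by rewrite l1'/=; lra.
  by rewrite mink_sumC; exact: mM.
- by rewrite mulr0 addr0; apply: one => //; [rewrite l0/= ltW|exact: mM].
have : \forall k \near \oo, (((l * a + (1 - l) * b) ^+ n)%:E <= gaussian (mink_sum l (1 - l) U W))%E.
  near=> k.
  pose Q : set V := thicken (k%:R : R) [set 0].
  have k0 : (0 : R) < k%:R by rewrite ltr0n; near: k; exact: nbhs_infty_gt.
  have oQ : cube_open Q by exact: cube_open_thicken.
  have cQ : cvx Q.
    apply: cvx_thicken => x y -> -> t t01; by rewrite !scaler0 addr0.
  have sQ : symm Q by apply: symm_thicken => x ->; rewrite /= oppr0.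
  have Q0 : Q 0 by exact: sub_thicken.
  have bQ (K : set V) : bounded_by k%:R (K `&` Q).
    move=> x [_ [y -> yx]] i; have := yx i; rewrite mxE subr0; exact: ltW.
  have oI (K : set V) : cube_open K -> cube_open (K `&` Q).
    move=> oK x [Kx Qx]; have [d d0 dK] := oK _ Kx; have [e e0 eQ] := oQ _ Qx.
    exists (Num.min d e); first by rewrite lt_min d0.
    move=> y xy; split; [apply: dK|apply: eQ] => i; apply: lt_le_trans (xy i) _.
      by rewrite ge_min lexx.
    by rewrite ge_min lexx orbT.
  have cI (K : set V) : cvx K -> cvx (K `&` Q).
    by move=> cK x y [Kx Qx] [Ky Qy] t t01; split; [exact: cK|exact: cQ].
  have sI (K : set V) : symm K -> symm (K `&` Q).
    by move=> sK x [Kx Qx]; split; [exact: sK|exact: sQ].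
  have aQ : ((a ^+ n)%:E < gaussian (U `&` Q))%E by rewrite /Q; near: k; exact: (gaussian_approx oU aU).
  have bQ' : ((b ^+ n)%:E < gaussian (W `&` Q))%E by rewrite /Q; near: k; exact: (gaussian_approx oW bW).
  apply: (@le_trans _ _ (gaussian (mink_sum l (1 - l) (U `&` Q) (W `&` Q)))).
    apply: (gaussian_mink_sum_bounded (oI _ oU) (oI _ oW) (cI _ cU) (cI _ cW) (sI _ sU) (sI _ sW)
      _ _ (bQ U) (bQ W) l01 a0 b0 (ltW aQ) (ltW bQ')); by split.
  apply: gaussian_le; [by apply: mM; exact: oI|exact: mM|].
  by move=> x [p [q [[Up _] [Wq _] ->]]]; exists p, q.
by move=> /filter_ex[].
Unshelve. all: by end_near. Qed.

End gaussian_brunn_minkowski.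

(** * From open sets to arbitrary symmetric convex sets *)

Section gauss_outer_measure.
Context {R : realType} {n : nat}.
Hypothesis n0 : (0 < n)%N.
Local Notation V := 'rV[R]_n.

Lemma measurable_thicken h (K : set V) : measurable (thicken h K).
Proof. by apply: measurable_cube_open; exact: cube_open_thicken. Qed.

Lemma gauss_measure_fin (K : set V) : gauss_measure K \is a fin_num.
Proof.
rewrite ge0_fin_numE ?gauss_measure_ge0//.
apply: le_lt_trans (gauss_measure_le_thicken K n0 ltr01) _.
by rewrite ltey_eq gaussian_fin//; exact: measurable_thicken.
Qed.

Lemma gaussian_thicken_cube (K : set V) (h r : R) : 0 < h -> 0 < r -> cvx K ->
  (forall x : V, (forall i, `|x ord0 i| <= r) -> K x) ->
  (gaussian (thicken h K) <= ((1 + h / r) ^+ n)%:E * gauss_measure K)%E.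
Proof.
move=> h0 r0 cK cube; pose rho := 1 + h / r.
have hr : 0 < h / r by exact: divr_gt0.
have rho0 : 0 < rho by rewrite /rho; lra.
have mT : measurable (thicken h K) by exact: measurable_thicken.
pose U : set V := [set x | thicken h K (rho *: x)].
have mU : measurable U.
  have mZ : measurable_fun setT (fun x : V => rho *: x) by exact: measurable_rvZ.
  by have := mZ measurableT _ mT; rewrite setTI.
apply: (@le_trans _ _ ((rho ^+ n)%:E * gaussian U)%E).
  by apply: gaussian_dilate_ge1 => //; rewrite /rho; lra.
apply: lee_wpmul2l; first by rewrite lee_fin exprn_ge0// ltW.
apply: gaussian_le_gauss_measure => // x /(thicken_scale h0 r0 cK cube).
by rewrite scalerA mulVf ?gt_eqF// scale1r.
Qed.

(** Moving each coordinate by less than [h] changes [dotp xi] by at most [h] times the absolute sum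
    of [xi], so the neighbourhood lies in a slab. *)
Lemma gaussian_thicken_hyperplane (K : set V) (xi : V) i (h : R) : 0 <= h ->
  xi ord0 i != 0 -> (forall x, K x -> dotp xi x = 0) ->
  (gaussian (thicken h K) <=
   (h * (normal_peak 1 * (2 * (\sum_l `|xi ord0 l|) / `|xi ord0 i|)))%:E)%E.
Proof.
move=> h0 xii K0; set T := \sum_l _.
have T0 : 0 <= T by exact: sumr_ge0.
have mT : measurable (thicken h K) by exact: measurable_thicken.
apply: (@le_trans _ _ (gaussian (slab xi 0 (h * T)))).
  apply: gaussian_le => //; first exact: measurable_slab.
  move=> x [y Ky yx]; rewrite /slab /= addr0.
  have -> : dotp xi x = \sum_l xi ord0 l * (x ord0 l - y ord0 l).
    under eq_bigr do rewrite mulrBr.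
    by rewrite sumrB -/(dotp xi x) -/(dotp xi y) (K0 _ Ky) subr0.
  apply: (le_trans (ler_norm_sum _ _ _)); rewrite mulr_sumr; apply: ler_sum => l _.
  by rewrite normrM mulrC; apply: ler_wpM2r => //; exact/ltW/yx.
apply: le_trans (gaussian_slab 0 xii (mulr_ge0 h0 T0)) _.
by rewrite lee_fin le_eqVlt; apply/orP; left; apply/eqP; ring.
Qed.

(** The neighbourhoods satisfy the inequality for every [h], and [h] tends to 0. If the combination
    contains a cube, its neighbourhood lies in a dilate of ratio near 1; if it lies in a hyperplane,
    the neighbourhood has measure [O(h)], which is incompatible with [c > 0]. *)
Lemma gauss_measure_mink_sum (K L : set V) (l a b : R) :
  cvx K -> cvx L -> symm K -> symm L -> K 0 -> L 0 -> 0 < l < 1 -> 0 <= a -> 0 <= b ->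
  (a = 0 \/ ((a ^+ n)%:E < gauss_measure K)%E) ->
  (b = 0 \/ ((b ^+ n)%:E < gauss_measure L)%E) ->
  (((l * a + (1 - l) * b) ^+ n)%:E <= gauss_measure (mink_sum l (1 - l) K L))%E.
Proof.
move=> cK cL sK sL K0 L0 l01 a0 b0 aK bL; set M := mink_sum _ _ _ _; set c := l * a + _.
have /andP[l0 l1] := l01.
have c_ge0 : 0 <= c by rewrite addr_ge0// mulr_ge0// ?subr_ge0 ltW.
have [cz|cn0] := eqVneq c 0.
  by rewrite cz expr0n (gtn_eqF n0) gauss_measure_ge0.
have c0 : 0 < c by rewrite lt_def cn0.
have step h : 0 < h -> ((c ^+ n)%:E <= gaussian (thicken h M))%E.
  move=> h0; have root (d : R) (S : set V) : 0 <= d ->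
      d = 0 \/ ((d ^+ n)%:E < gauss_measure S)%E -> below_root d (gaussian (thicken h S)) (n := n).
    move=> d0 [->|dS]; first by left.
    have [->|dn0] := eqVneq d 0; first by left.
    right; split; first by rewrite lt_def dn0.
    by apply: lt_le_trans dS _; exact: gauss_measure_le_thicken.
  have oK : cube_open (thicken h K) by exact: cube_open_thicken.
  have oL : cube_open (thicken h L) by exact: cube_open_thicken.
  have l01' : 0 <= l <= 1 by rewrite !ltW.
  apply: (@le_trans _ _ (gaussian (mink_sum l (1 - l) (thicken h K) (thicken h L)))).
    apply: (gaussian_mink_sum n0 oK oL) => //; [exact: cvx_thicken|exact: cvx_thicken|
      exact: symm_thicken|exact: symm_thicken|exact: sub_thicken|exact: sub_thicken|
      exact: root|exact: root].
  apply: gaussian_le; last exact: mink_sum_thicken.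
    by apply: measurable_cube_open; apply: cube_open_mink_sum => //; lra.
  exact: measurable_thicken.
have cM : cvx M by exact: cvx_mink_sum.
have M0 : M 0 by exists 0, 0; rewrite !scaler0 addr0.
have [[r r0 cube]|[xi [i [xii Mxi]]]] := cube_or_hyperplane cM (symm_mink_sum sK sL) M0.
  have z0 : 0 <= fine (gauss_measure M) by apply: fine_ge0; exact: gauss_measure_ge0.
  rewrite -(fineK (gauss_measure_fin M)) lee_fin.
  have gn := powR_invn_exprn n0 z0.
  move: gn (powR_ge0 (fine (gauss_measure M)) n%:R^-1).
  move: (_ `^ _) => g gn g0.
  rewrite -gn ler_pXn2r ?nnegrE//; apply/ler_addgt0Pr => e e0.
  have g1 : 0 < g + 1 by lra.
  (* With this width the ratio [1 + h / r] enlarges [g] by at most [e]; the [+ 1] covers [g = 0]. *)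
  have h0 : 0 < r * e / (g + 1) by rewrite divr_gt0// mulr_gt0.
  have := le_trans (step _ h0) (gaussian_thicken_cube h0 r0 cM cube).
  rewrite -(fineK (gauss_measure_fin M)) -EFinM lee_fin -gn -exprMn.
  have -> : r * e / (g + 1) / r = e / (g + 1) by field; rewrite !gt_eqF.
  have eg : 0 <= e / (g + 1) by rewrite divr_ge0// ltW.
  rewrite ler_pXn2r ?nnegrE//; last by rewrite mulr_ge0//; lra.
  move=> /le_trans; apply; rewrite mulrDl mul1r lerD2l mulrAC ler_pdivrMr//.
  by rewrite ler_pM2l//; lra.
set C := normal_peak 1 * (2 * (\sum_l `|xi ord0 l|) / `|xi ord0 i|).
have C0 : 0 <= C.
  by rewrite mulr_ge0 ?normal_peak_ge0// divr_ge0// mulr_ge0// sumr_ge0.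
have cn : 0 < c ^+ n by rewrite exprn_gt0.
(* This width makes the slab bound [h * C] smaller than [c ^+ n]. *)
have h0 : 0 < c ^+ n / (C + 1) by rewrite divr_gt0//; lra.
have := le_trans (step _ h0) (gaussian_thicken_hyperplane (ltW h0) xii Mxi).
rewrite lee_fin -/C mulrAC ler_pdivlMr; last by lra.
by rewrite ler_pM2l// => C1; exfalso; lra.
Qed.

End gauss_outer_measure.

Theorem theorem1p1 (R : realType) (n : nat) (K L : set 'rV[R]_n) (lambda : R) :
  (0 < n)%N ->
  K !=set0 -> L !=set0 ->
  convex K -> convex L ->
  origin_symmetric K -> origin_symmetric L ->
  0 < lambda < 1 ->
  lambda * (fine (gauss_measure K) `^ (n%:R^-1))
    + (1 - lambda) * (fine (gauss_measure L) `^ (n%:R^-1))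
  <= fine (gauss_measure (minkowski_comb lambda K L)) `^ (n%:R^-1).
Proof.
move=> n0 Kne Lne /convex_cvx cK /convex_cvx cL symK symL l01.
have symP (S : set 'rV[R]_n) : origin_symmetric S -> symm S.
  by move=> SE x Sx; rewrite SE; exists x.
have sK := symP _ symK; have sL := symP _ symL.
have K0 := cvx_symm0 Kne cK sK; have L0 := cvx_symm0 Lne cL sL.
have -> : minkowski_comb lambda K L = mink_sum lambda (1 - lambda) K L.
  apply/seteqP; split => x [a].
    by move=> Ka [b Lb <-]; exists a, b.
  by move=> [b [Ka Lb ->]]; exists a => //; exists b.
set M := mink_sum _ _ _ _.
have root (S : set 'rV[R]_n) : (fine (gauss_measure S) `^ n%:R^-1) ^+ n = fine (gauss_measure S).
  by apply: powR_invn_exprn => //; apply: fine_ge0; exact: gauss_measure_ge0.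
have root0 (S : set 'rV[R]_n) := powR_ge0 (fine (gauss_measure S)) n%:R^-1.
apply/ler_addgt0Pr => e e0.
(* Lowering each root by [e] yields the strict inequality required, with 0 when the root is at most
   [e]. The total loss is [e], as the coefficients add up to 1. *)
pose down (S : set 'rV[R]_n) := Num.max 0 (fine (gauss_measure S) `^ n%:R^-1 - e).
have down_lt S : down S = 0 \/ ((down S ^+ n)%:E < gauss_measure S)%E.
  have [le0|gt0] := leP (fine (gauss_measure S) `^ n%:R^-1 - e) 0.
    by left; apply/max_idPl.
  right; rewrite (_ : down S = fine (gauss_measure S) `^ n%:R^-1 - e); last exact/max_idPr/ltW.
  rewrite -[X in (_ < X)%E](fineK (gauss_measure_fin n0 S)) lte_fin -[X in _ < X]root.
  by rewrite ltr_pXn2r ?nnegrE//; lra.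
have down0 S : 0 <= down S by rewrite /down le_max lexx.
have down_ge S : fine (gauss_measure S) `^ n%:R^-1 - e <= down S by rewrite /down le_max lexx orbT.
have H := gauss_measure_mink_sum n0 cK cL sK sL K0 L0 l01 (down0 K) (down0 L) (down_lt K) (down_lt L).
have /andP[l0 l1] := l01; have l1' : 0 <= 1 - lambda by lra.
have {}H : lambda * down K + (1 - lambda) * down L <= fine (gauss_measure M) `^ n%:R^-1.
  move: H; rewrite -(fineK (gauss_measure_fin n0 M)) lee_fin -[in X in X -> _](root M).
  by rewrite ler_pXn2r ?nnegrE// addr_ge0// mulr_ge0// ltW.
have := ler_wpM2l (ltW l0) (down_ge K); have := ler_wpM2l l1' (down_ge L).
move: H; set A := _ `^ _; set B := _ `^ _; set G := _ `^ _ => H.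
by move: H; clearbody A B G; move: (down K) (down L) => dK dL; clear; lra.
Qed.
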